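(* For every Nijenhuis $(1,1)$-tensor field $N$ on a Lie algebroid $(A,[\cdot,\cdot],\rho)$, the extension of $N$ by derivation, $\underline N$, is a Nijenhuis vector valued $1$-form with respect to the multiplicative graded Lie algebra structure $l_2^{[\cdot,\cdot]}$ on the graded vector space $\Gamma(\wedge A)[2]$, with square $\underline{(N^2)}$.
   Context: $(A,[\cdot,\cdot],\rho)$ is a Lie algebroid over a manifold $M$. A $(1,1)$-tensor field is a $C^\infty(M)$-linear map $N:\Gamma(A)\to\Gamma(A)$; $[X,Y]_N=[NX,Y]+[X,NY]-N[X,Y]$; $N$ is Nijenhuis if $[NX,NY]-N([X,Y]_N)=0$ for all $X,Y\in\Gamma(A)$. Extension by derivation: $\underline N(f)=0$ for $f\in C^\infty(M)$ and $\underline N(P_1\wedge\cdots\wedge P_p)=\sum_{i}P_1\wedge\cdots\wedge N(P_i)\wedge\cdots\wedge P_p$. $\Gamma(\wedge A)[2]$: elements of $\Gamma(\wedge^pA)$ have degree $p-2$. The Schouten–Nijenhuis bracket is the unique bilinear bracket on $\Gamma(\wedge A)$ with $[X,f]_{_{SN}}=\rho(X)f$, $[X,Y]_{_{SN}}=[X,Y]$ for $X,Y\in\Gamma(A)$, $f \in C^\infty(M)$, $[f,g]_{_{SN}}=0$, and for $P\in\Gamma(\wedge^{p}A)$, $Q\in\Gamma(\wedge^qA)$: $[P,Q]_{_{SN}}=-(-1)^{(p-1)(q-1)}[Q,P]_{_{SN}}$, $[P,Q\wedge R]_{_{SN}}=[P,Q]_{_{SN}}\wedge R+(-1)^{(p-1)q}Q\wedge[P,R]_{_{SN}}$.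 Set $l_2^{[\cdot,\cdot]}(P,Q)=(-1)^{p-1}[P,Q]_{_{SN}}$ for $P\in\Gamma(\wedge^pA)$, a graded symmetric bilinear map of degree $1$ on $\Gamma(\wedge A)[2]$. On a graded vector space, a symmetric vector valued $k$-form is a graded symmetric $k$-linear map $K$ (exchanging adjacent arguments $X,Y$ gives $(-1)^{|X||Y|}$), of degree $\bar K$ if $|K(X_1,\dots,X_k)|=\sum|X_i|+\bar K$. For a $k$-form $K$ and $l$-form $L$, $$\iota_KL(X_1,\dots,X_{k+l-1})=\sum_{\sigma\in Sh(k,l-1)}\epsilon(\sigma)L(K(X_{\sigma(1)},\dots,X_{\sigma(k)}),X_{\sigma(k+1)},\dots,X_{\sigma(k+l-1)})$$ (unshuffles, Koszul sign), and $[K,L]_{_{RN}}=\iota_KL-(-1)^{\bar K\bar L}\iota_LK$. For $\mu$ of degree $1$, $\mathcal N$ of degree $0$ is Nijenhuis with respect to $\mu$ with square $\mathcal K$ if $\mathcal K$ has degree $0$, $[\mathcal N,[\mathcal N,\mu]_{_{RN}}]_{_{RN}}=[\mathcal K,\mu]_{_{RN}}$ and $[\mathcal N,\mathcal K]_{_{RN}}=0$. *)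

(* Defs.v *)
From HB Require Import structures.
From mathcomp Require Import all_boot all_order all_algebra perm.
From mathcomp Require Import all_classical all_reals all_analysis.
Set Implicit Arguments.
Unset Strict Implicit.
Unset Printing Implicit Defensive.
Import Order.TTheory GRing.Theory Num.Theory.
Import numFieldNormedType.Exports.
Local Open Scope classical_set_scope.
Local Open Scope ring_scope.

(* (-1)^z for an integer exponent z, which only depends on the parity of z. *)
Definition ksign (R : nzRingType) (z : int) : R := (-1) ^+ `|z|%N.

(******************************************************************************)
(* Exterior algebra of a module V: the associative unital R-algebra presented *)
(* by the generators v in V, subject to R-linearity in v and to v * v = 0.    *)
(* It is built as formal expressions modulo the congruence generated by the   *)
(* algebra axioms and these relations; the product of ext V is the wedge.     *)
(******************************************************************************)
Section ExteriorAlgebra.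
Variables (R : comNzRingType) (V : lmodType R).

Inductive ext_expr : Type :=
| EVec of V
| EScal of R
| EAdd of ext_expr & ext_expr
| EMul of ext_expr & ext_expr.

Inductive ext_eq : ext_expr -> ext_expr -> Prop :=
| ext_refl a : ext_eq a a
| ext_sym a b : ext_eq a b -> ext_eq b a
| ext_trans b a c : ext_eq a b -> ext_eq b c -> ext_eq a c
| ext_add a a' b b' : ext_eq a a' -> ext_eq b b' ->
    ext_eq (EAdd a b) (EAdd a' b')
| ext_mul a a' b b' : ext_eq a a' -> ext_eq b b' ->
    ext_eq (EMul a b) (EMul a' b')
| ext_addA a b c : ext_eq (EAdd a (EAdd b c)) (EAdd (EAdd a b) c)
| ext_addC a b : ext_eq (EAdd a b) (EAdd b a)
| ext_add0 a : ext_eq (EAdd (EScal 0) a) a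
| ext_addN a : ext_eq (EAdd (EMul (EScal (-1)) a) a) (EScal 0)
| ext_mulA a b c : ext_eq (EMul a (EMul b c)) (EMul (EMul a b) c)
| ext_mul1 a : ext_eq (EMul (EScal 1) a) a
| ext_mulDl a b c : ext_eq (EMul (EAdd a b) c) (EAdd (EMul a c) (EMul b c))
| ext_mulDr a b c : ext_eq (EMul a (EAdd b c)) (EAdd (EMul a b) (EMul a c))
| ext_scalC k a : ext_eq (EMul (EScal k) a) (EMul a (EScal k))
| ext_scalD k l : ext_eq (EScal (k + l)) (EAdd (EScal k) (EScal l))
| ext_scalM k l : ext_eq (EScal (k * l)) (EMul (EScal k) (EScal l))
| ext_vec k u v :
    ext_eq (EVec (k *: u + v)) (EAdd (EMul (EScal k) (EVec u)) (EVec v))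
| ext_vec_sqr v : ext_eq (EMul (EVec v) (EVec v)) (EScal 0).

HB.instance Definition _ := gen_eqMixin ext_expr.
HB.instance Definition _ := gen_choiceMixin ext_expr.

Definition ext_eqb (a b : ext_expr) : bool := `[< ext_eq a b >].

Lemma ext_eqb_refl : reflexive ext_eqb.
Proof. by move=> a; apply/asboolP/ext_refl. Qed.

Lemma ext_eqb_sym : symmetric ext_eqb.
Proof. by move=> a b; apply: asbool_equiv_eq; split; apply: ext_sym. Qed.

Lemma ext_eqb_trans : transitive ext_eqb.
Proof. by move=> b a c /asboolP ab /asboolP bc; apply/asboolP/(ext_trans ab). Qed.

Canonical ext_equiv := EquivRel ext_eqb ext_eqb_refl ext_eqb_sym ext_eqb_trans.

Definition ext := {eq_quot ext_equiv}%qT.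

HB.instance Definition _ := Choice.on ext.

Definition ext_pi (a : ext_expr) : ext := (\pi_({eq_quot ext_equiv}) a)%qT.
Definition ext_repr (x : ext) : ext_expr := repr (x : {eq_quot ext_equiv}%qT).

Lemma ext_reprK x : ext_pi (ext_repr x) = x.
Proof. exact: reprK. Qed.

Lemma ext_piP a b : ext_pi a = ext_pi b <-> ext_eq a b.
Proof.
split=> [/(@eqmodP _ ext_equiv a b)/asboolP // | ab].
exact/(@eqmodP _ ext_equiv a b)/asboolP.
Qed.

Lemma ext_repr_pi a : ext_eq (ext_repr (ext_pi a)) a.
Proof. by apply/ext_piP; rewrite ext_reprK. Qed.

Definition ext_addd (x y : ext) := ext_pi (EAdd (ext_repr x) (ext_repr y)).
Definition ext_muld (x y : ext) := ext_pi (EMul (ext_repr x) (ext_repr y)).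
Definition ext_scaled (k : R) (x : ext) := ext_pi (EMul (EScal k) (ext_repr x)).
Definition ext_oppd (x : ext) := ext_scaled (-1) x.

Lemma ext_adddE a b : ext_addd (ext_pi a) (ext_pi b) = ext_pi (EAdd a b).
Proof. by apply/ext_piP/ext_add; apply: ext_repr_pi. Qed.

Lemma ext_muldE a b : ext_muld (ext_pi a) (ext_pi b) = ext_pi (EMul a b).
Proof. by apply/ext_piP/ext_mul; apply: ext_repr_pi. Qed.

Lemma ext_scaledE k a : ext_scaled k (ext_pi a) = ext_pi (EMul (EScal k) a).
Proof. by apply/ext_piP/ext_mul; [apply: ext_refl | apply: ext_repr_pi]. Qed.

Fact ext_adddA : associative ext_addd.
Proof.
move=> x y z; rewrite -[x]ext_reprK -[y]ext_reprK -[z]ext_reprK !ext_adddE.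
exact/ext_piP/ext_addA.
Qed.

Fact ext_adddC : commutative ext_addd.
Proof.
move=> x y; rewrite -[x]ext_reprK -[y]ext_reprK !ext_adddE.
exact/ext_piP/ext_addC.
Qed.

Fact ext_addd0 : left_id (ext_pi (EScal 0)) ext_addd.
Proof. by move=> x; rewrite -[x]ext_reprK ext_adddE; exact/ext_piP/ext_add0. Qed.

Fact ext_adddN : left_inverse (ext_pi (EScal 0)) ext_oppd ext_addd.
Proof.
move=> x; rewrite -[x]ext_reprK /ext_oppd ext_scaledE ext_adddE.
exact/ext_piP/ext_addN.
Qed.

HB.instance Definition _ :=
  GRing.isZmodule.Build ext ext_adddA ext_adddC ext_addd0 ext_adddN.

Fact ext_muldA : associative ext_muld.
Proof.
move=> x y z; rewrite -[x]ext_reprK -[y]ext_reprK -[z]ext_reprK !ext_muldE.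
exact/ext_piP/ext_mulA.
Qed.

Fact ext_muld1l : left_id (ext_pi (EScal 1)) ext_muld.
Proof. by move=> x; rewrite -[x]ext_reprK ext_muldE; exact/ext_piP/ext_mul1. Qed.

Fact ext_muld1r : right_id (ext_pi (EScal 1)) ext_muld.
Proof.
move=> x; rewrite -[x]ext_reprK ext_muldE; apply/ext_piP.
exact: ext_trans (ext_sym (ext_scalC _ _)) (ext_mul1 _).
Qed.

Fact ext_muldDl : left_distributive ext_muld ext_addd.
Proof.
move=> x y z; rewrite -[x]ext_reprK -[y]ext_reprK -[z]ext_reprK.
by rewrite !(ext_muldE, ext_adddE); exact/ext_piP/ext_mulDl.
Qed.

Fact ext_muldDr : right_distributive ext_muld ext_addd.
Proof.
move=> x y z; rewrite -[x]ext_reprK -[y]ext_reprK -[z]ext_reprK.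
by rewrite !(ext_muldE, ext_adddE); exact/ext_piP/ext_mulDr.
Qed.

Fixpoint ext_augm (a : ext_expr) : R :=
  match a with
  | EVec _ => 0
  | EScal k => k
  | EAdd a b => ext_augm a + ext_augm b
  | EMul a b => ext_augm a * ext_augm b
  end.

Lemma ext_augmP a b : ext_eq a b -> ext_augm a = ext_augm b.
Proof.
elim=> //= {a b}.
- by move=> b a c _ -> _ ->.
- by move=> a a' b b' _ -> _ ->.
- by move=> a a' b b' _ -> _ ->.
- by move=> *; rewrite addrA.
- by move=> *; rewrite addrC.
- by move=> *; rewrite add0r.
- by move=> *; rewrite mulN1r addNr.
- by move=> *; rewrite mulrA.
- by move=> *; rewrite mul1r.
- by move=> *; rewrite mulrDl.
- by move=> *; rewrite mulrDr.
- by move=> *; rewrite mulrC.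
- by move=> *; rewrite mulr0 addr0.
- by move=> *; rewrite mulr0.
Qed.

Fact ext_one_neq0 : ext_pi (EScal 1) != ext_pi (EScal 0).
Proof. by apply/eqP => /ext_piP/ext_augmP/eqP; rewrite /= oner_eq0. Qed.

HB.instance Definition _ := GRing.Zmodule_isNzRing.Build ext
  ext_muldA ext_muld1l ext_muld1r ext_muldDl ext_muldDr ext_one_neq0.

Lemma ext_scaledM k x : ext_scaled k x = ext_muld (ext_pi (EScal k)) x.
Proof. by rewrite -[x]ext_reprK ext_scaledE ext_muldE. Qed.

Fact ext_scaledA k l x : ext_scaled k (ext_scaled l x) = ext_scaled (k * l) x.
Proof.
rewrite !ext_scaledM ext_muldA ext_muldE; congr ext_muld.
exact/ext_piP/ext_sym/ext_scalM.
Qed.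

Fact ext_scaled1 : left_id 1 ext_scaled.
Proof. by move=> x; rewrite ext_scaledM ext_muld1l. Qed.

Fact ext_scaledDr : right_distributive ext_scaled +%R.
Proof. by move=> k x y; rewrite !ext_scaledM ext_muldDr. Qed.

Fact ext_scaledDl x : {morph ext_scaled^~ x : k l / k + l}.
Proof.
move=> k l; rewrite !ext_scaledM -[RHS]ext_muldDl ext_adddE.
by congr ext_muld; exact/ext_piP/ext_scalD.
Qed.

HB.instance Definition _ := GRing.Zmodule_isLmodule.Build R ext
  ext_scaledA ext_scaled1 ext_scaledDr ext_scaledDl.

Fact ext_scalerAl (k : R) (x y : ext) : k *: (x * y) = (k *: x) * y.
Proof. by rewrite /GRing.scale /= !ext_scaledM; apply: ext_muldA. Qed.

HB.instance Definition _ := GRing.Lmodule_isLalgebra.Build R ext ext_scalerAl.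

Fact ext_scalerAr (k : R) (x y : ext) : k *: (x * y) = x * (k *: y).
Proof.
rewrite /GRing.scale /= !ext_scaledM [LHS]ext_muldA [RHS]ext_muldA.
congr ext_muld; rewrite -[x]ext_reprK !ext_muldE.
exact/ext_piP/ext_scalC.
Qed.

HB.instance Definition _ := GRing.Lalgebra_isAlgebra.Build R ext ext_scalerAr.

Definition ext_inj (v : V) : ext := ext_pi (EVec v).

Definition ext_pow (p : nat) : set ext :=
  [set x | exists (m : nat) (c : 'I_m -> R) (v : 'I_m -> 'I_p -> V),
     x = \sum_(k < m) c k *: \prod_(i < p) ext_inj (v k i)].

End ExteriorAlgebra.

(******************************************************************************)
(* Symmetric vector valued forms on a graded vector space, given by an        *)
(* ambient space V and its homogeneous components H d, d : int.  Arguments    *)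
(* are lists of pairs (degree, vector): a form is determined by its values on *)
(* homogeneous arguments, i.e., on lists X such that H x.1 x.2 for x in X.    *)
(******************************************************************************)
Section VectorValuedForms.
Variables (R : fieldType) (V : lmodType R) (H : int -> set V).

Definition homogeneous (X : seq (int * V)) : Prop :=
  forall i, (i < size X)%N -> H (nth (0, 0) X i).1 (nth (0, 0) X i).2.

Definition total_degree (X : seq (int * V)) : int := \sum_(x <- X) x.1.

Record vform := VForm {
  arity : nat;
  vdegree : int;
  vapp :> seq (int * V) -> V }.

Definition symmetric_vform (K : vform) : Prop :=
  [/\ forall X, size X = arity K -> homogeneous X ->
        H (total_degree X + vdegree K) (K X),
      forall X Y d (k : R) (u v : V), ((size X + size Y).+1)%N = arity K ->
        homogeneous (X ++ (d, u) :: Y) -> homogeneous (X ++ (d, v) :: Y) ->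
        K (X ++ (d, k *: u + v) :: Y) =
          k *: K (X ++ (d, u) :: Y) + K (X ++ (d, v) :: Y)
    & forall X Y x y, ((size X + size Y).+2)%N = arity K ->
        homogeneous (X ++ x :: y :: Y) ->
        K (X ++ x :: y :: Y) =
          ksign R (x.1 * y.1) *: K (X ++ y :: x :: Y)].

Definition unshuffle (n k : nat) (s : 'S_n) : bool :=
  [forall i : 'I_n, forall j : 'I_n,
     (i < j)%N && ((j < k)%N || (k <= i)%N) ==> (s i < s j)%N].

Definition permuted (X : seq (int * V)) (s : 'S_(size X)) : seq (int * V) :=
  [seq nth (0, 0) X (s i) | i <- enum 'I_(size X)].

Definition koszul_sign (X : seq (int * V)) (s : 'S_(size X)) : R :=
  \prod_(i < size X) \prod_(j < size X | (i < j)%N && (s j < s i)%N)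
    ksign R ((nth (0, 0) X (s i)).1 * (nth (0, 0) X (s j)).1).

Definition insertion (K L : vform) (X : seq (int * V)) : V :=
  \sum_(s : 'S_(size X) | unshuffle (arity K) s)
    let Y := permuted s in
    let Y1 := take (arity K) Y in
    koszul_sign s *:
      L ((total_degree Y1 + vdegree K, K Y1) :: drop (arity K) Y).

Definition RN_bracket (K L : vform) : vform :=
  VForm ((arity K + arity L).-1)%N (vdegree K + vdegree L)
    (fun X => insertion K L X -
              ksign R (vdegree K * vdegree L) *: insertion L K X).

Definition eq_vform (K L : vform) : Prop :=
  arity K = arity L /\
  forall X, size X = arity K -> homogeneous X -> K X = L X.

Definition null_vform (K : vform) : Prop :=
  forall X, size X = arity K -> homogeneous X -> K X = 0.

Definition nijenhuis_vform (mu N K : vform) : Prop :=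
  [/\ symmetric_vform mu /\ vdegree mu = 1,
      symmetric_vform N /\ vdegree N = 0,
      symmetric_vform K /\ vdegree K = 0,
      eq_vform (RN_bracket N (RN_bracket N mu)) (RN_bracket K mu)
    & null_vform (RN_bracket N K)].

Definition vform1 (d : int) (f : V -> V) : vform :=
  VForm 1 d (fun X => f (nth (0, 0) X 0).2).

Definition vform2 (d : int) (f : int * V -> int * V -> V) : vform :=
  VForm 2 d (fun X => f (nth (0, 0) X 0) (nth (0, 0) X 1)).

End VectorValuedForms.

Section SmoothMaps.
Variables (R : realType) (n : nat) (W : normedModType R).

(* U is meant to be open: derivatives at x in U only depend on f near x. *)
Fixpoint Ck_on (k : nat) (U : set 'rV[R]_n) (f : 'rV[R]_n -> W) : Prop :=
  match k with
  | 0 => forall x, U x -> {for x, continuous f}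
  | k'.+1 => (forall x, U x -> differentiable f x) /\
             (forall v, Ck_on k' U (fun x => 'D_v f x))
  end.

Definition smooth_on (U : set 'rV[R]_n) (f : 'rV[R]_n -> W) : Prop :=
  forall k, Ck_on k U f.

End SmoothMaps.

(* The functions chart i and chart_inv i are only meaningful on chart_dom i   *)
(* and on its image.                                                          *)
Record manifold (R : realType) (n : nat) := Manifold {
  carrier :> topologicalType;
  manifold_hausdorff : hausdorff_space carrier;
  manifold_second_countable : @second_countable carrier;
  chart_index : Type;
  chart_dom : chart_index -> set carrier;
  chart : chart_index -> carrier -> 'rV[R]_n;
  chart_inv : chart_index -> 'rV[R]_n -> carrier;
  chart_dom_open : forall i, open (chart_dom i);
  chart_cover : forall x, exists i, chart_dom i x;
  chart_image_open : forall i, open (chart i @` chart_dom i);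
  chartK : forall i x, chart_dom i x -> chart_inv i (chart i x) = x;
  chart_continuous : forall i x,
    chart_dom i x -> {for x, continuous (chart i)};
  chart_inv_continuous : forall i u,
    (chart i @` chart_dom i) u -> {for u, continuous (chart_inv i)};
  chart_smooth : forall i j,
    smooth_on (chart i @` (chart_dom i `&` chart_dom j))
      (chart j \o chart_inv i) }.

Section SmoothFunctions.
Variables (R : realType) (n : nat) (M : manifold R n).

(* U is meant to be open, so that the image below is open as well. *)
Definition smooth_map (W : normedModType R) (U : set M) (f : M -> W) : Prop :=
  forall i, smooth_on (chart i @` (chart_dom i `&` U)) (f \o chart_inv i).

Definition smooth (f : M -> R) : Prop := smooth_map (W := R^o) setT f.

(* Tangent vectors at x as point derivations of the smooth functions at x. *)
Definition tangent_vector (x : M) (D : (M -> R) -> R) : Prop :=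
  (forall (k : R) f g, smooth f -> smooth g ->
     D (fun y => k * f y + g y) = k * D f + D g) /\
  (forall f g, smooth f -> smooth g ->
     D (fun y => f y * g y) = D f * g x + f x * D g).

(* A vector bundle is given by its fibers and by local trivializations with   *)
(* smooth transition matrices; this data determines the total space.          *)
Record vbundle := VBundle {
  rank : nat;
  fiber : M -> lmodType R;
  triv_index : Type;
  triv_dom : triv_index -> set M;
  triv : triv_index -> forall x, {linear fiber x -> 'rV[R]_rank};
  triv_dom_open : forall a, open (triv_dom a);
  triv_cover : forall x, exists a, triv_dom a x;
  triv_bij : forall a x, triv_dom a x -> bijective (triv a x);
  triv_smooth : forall a b, exists2 g : M -> 'M[R]_rank,
    smooth_map (triv_dom a `&` triv_dom b) g &
    forall x, (triv_dom a `&` triv_dom b) x ->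
      forall v : fiber x, triv b x v = triv a x v *m g x }.

End SmoothFunctions.

(* Set-theoretic sections of a family of vector spaces, with their pointwise  *)
(* vector space structure.                                                    *)
Section Sections.
Variables (R : nzRingType) (T : Type) (F : T -> lmodType R).

Definition sec : Type := forall x, F x.

HB.instance Definition _ := gen_eqMixin sec.
HB.instance Definition _ := gen_choiceMixin sec.

Implicit Types s t u : sec.

Definition sec_zero : sec := fun x => 0.
Definition sec_opp s : sec := fun x => - s x.
Definition sec_add s t : sec := fun x => s x + t x.
Definition sec_scale (k : R) s : sec := fun x => k *: s x.

Fact sec_addA : associative sec_add.
Proof. by move=> s t u; apply: functional_extensionality_dep => x; apply: addrA. Qed.

Fact sec_addC : commutative sec_add.
Proof. by move=> s t; apply: functional_extensionality_dep => x; apply: addrC. Qed.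

Fact sec_add0 : left_id sec_zero sec_add.
Proof. by move=> s; apply: functional_extensionality_dep => x; apply: add0r. Qed.

Fact sec_addN : left_inverse sec_zero sec_opp sec_add.
Proof. by move=> s; apply: functional_extensionality_dep => x; apply: addNr. Qed.

HB.instance Definition _ :=
  GRing.isZmodule.Build sec sec_addA sec_addC sec_add0 sec_addN.

Fact sec_scaleA k l s : sec_scale k (sec_scale l s) = sec_scale (k * l) s.
Proof. by apply: functional_extensionality_dep => x; apply: scalerA. Qed.

Fact sec_scale1 : left_id 1 sec_scale.
Proof. by move=> s; apply: functional_extensionality_dep => x; apply: scale1r. Qed.

Fact sec_scaleDr : right_distributive sec_scale +%R.
Proof. by move=> k s t; apply: functional_extensionality_dep => x; apply: scalerDr. Qed.

Fact sec_scaleDl s : {morph sec_scale^~ s : k l / k + l}.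
Proof. by move=> k l; apply: functional_extensionality_dep => x; apply: scalerDl. Qed.

HB.instance Definition _ := GRing.Zmodule_isLmodule.Build R sec
  sec_scaleA sec_scale1 sec_scaleDr sec_scaleDl.

Definition fscale (f : T -> R) s : sec := fun x => f x *: s x.

End Sections.

Section SectionsOfBundles.
Variables (R : realType) (n : nat) (M : manifold R n) (A : vbundle M).

Definition smooth_sec (X : sec (fiber A)) : Prop :=
  forall a, smooth_map (triv_dom a) (fun x => triv a x (X x)).

(* The local frame over triv_dom a; its value elsewhere is irrelevant. *)
Definition frame (a : triv_index A) (j : 'I_(rank A)) : sec (fiber A) :=
  fun x => xget 0 [set v | triv a x v = delta_mx 0 j].

Definition multisec : lmodType R :=
  sec (fun x => ext (fiber A x) : lmodType R).

(* Smoothness is that of the coefficients in the basis of the wedge products  *)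
(* of a local frame, taken in increasing order of the indices.                *)
Definition smooth_multisec (P : multisec) : Prop :=
  forall a, exists2 c : {set 'I_(rank A)} -> M -> R,
    forall I, smooth_map (W := R^o) (triv_dom a) (c I) &
    forall x, triv_dom a x ->
      P x = \sum_I c I x *: \prod_(j in I) ext_inj (frame a j x).

Definition multisec_deg (p : nat) : set multisec :=
  [set P | smooth_multisec P /\ forall x, ext_pow p (P x)].

(* Sections of the p-th exterior power have degree p - 2; the components of   *)
(* degree less than -2 are null.                                              *)
Definition shifted_deg (d : int) : set multisec :=
  match d + 2 with
  | Posz p => multisec_deg p
  | Negz _ => [set 0]
  end.

Definition wedge (P Q : multisec) : multisec := fun x => P x * Q x.

Definition of_fun (f : M -> R) : multisec := fun x => f x *: 1.

Definition of_sec (X : sec (fiber A)) : multisec := fun x => ext_inj (X x).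

Definition wedge_prod (p : nat) (X : 'I_p -> sec (fiber A)) : multisec :=
  fun x => \prod_(i < p) ext_inj (X i x).

End SectionsOfBundles.

(* The bracket is only constrained on smooth sections.  The anchor maps x and *)
(* v in the fiber at x to a point derivation, i.e., a tangent vector at x; it *)
(* is a bundle map since it sends smooth sections to smooth vector fields.    *)
(* That it preserves brackets follows from the Jacobi and Leibniz identities. *)
Record lie_algebroid (R : realType) (n : nat) (M : manifold R n) :=
  LieAlgebroid {
  bundle :> vbundle M;
  lbracket : sec (fiber bundle) -> sec (fiber bundle) -> sec (fiber bundle);
  anchor : forall x, fiber bundle x -> (M -> R) -> R;
  lbracket_smooth : forall X Y,
    smooth_sec X -> smooth_sec Y -> smooth_sec (lbracket X Y);
  lbracket_linear : forall (k : R) X Y Z,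
    smooth_sec X -> smooth_sec Y -> smooth_sec Z ->
    lbracket (k *: X + Y) Z = k *: lbracket X Z + lbracket Y Z;
  lbracket_anti : forall X Y,
    smooth_sec X -> smooth_sec Y -> lbracket X Y = - lbracket Y X;
  lbracket_jacobi : forall X Y Z,
    smooth_sec X -> smooth_sec Y -> smooth_sec Z ->
    lbracket X (lbracket Y Z) + lbracket Y (lbracket Z X)
      + lbracket Z (lbracket X Y) = 0;
  anchor_tangent : forall x v, tangent_vector x (anchor (x := x) v);
  anchor_linear : forall x (k : R) (u v : fiber bundle x) f, smooth f ->
    anchor (k *: u + v) f = k * anchor u f + anchor v f;
  anchor_smooth : forall X f, smooth_sec X -> smooth f ->
    smooth (fun x => anchor (X x) f);
  lbracket_leibniz : forall X Y f, smooth_sec X -> smooth_sec Y -> smooth f ->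
    lbracket X (fscale f Y) =
      fscale f (lbracket X Y) + fscale (fun x => anchor (X x) f) Y }.

Section NijenhuisTensors.
Variables (R : realType) (n : nat) (M : manifold R n) (A : lie_algebroid M).

Definition tensor11 (N : sec (fiber A) -> sec (fiber A)) : Prop :=
  (forall X, smooth_sec X -> smooth_sec (N X)) /\
  (forall f X Y, smooth f -> smooth_sec X -> smooth_sec Y ->
     N (fscale f X + Y) = fscale f (N X) + N Y).

Definition deformed_bracket (N : sec (fiber A) -> sec (fiber A)) X Y :=
  lbracket (N X) Y + lbracket X (N Y) - N (lbracket X Y).

Definition nijenhuis_tensor (N : sec (fiber A) -> sec (fiber A)) : Prop :=
  tensor11 N /\
  forall X Y, smooth_sec X -> smooth_sec Y ->
    lbracket (N X) (N Y) - N (deformed_bracket N X Y) = 0.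

(* The last two clauses give the values of D on functions and on decomposable *)
(* elements.  Smooth sections of the exterior bundle are finite sums of these,*)
(* so that D is determined by linearity.                                      *)
Definition derivation_extension (N : sec (fiber A) -> sec (fiber A))
    (D : multisec A -> multisec A) : Prop :=
  [/\ forall P, smooth_multisec P -> smooth_multisec (D P),
      forall f P Q, smooth f -> smooth_multisec P -> smooth_multisec Q ->
        D (fscale f P + Q) = fscale f (D P) + D Q,
      forall f, smooth f -> D (of_fun A f) = 0
    & forall (p : nat) (X : 'I_p -> sec (fiber A)),
        (forall i, smooth_sec (X i)) ->
        D (wedge_prod X) =
          \sum_(i < p) wedge_prod (fun j => if j == i then N (X j) else X j)].

Definition schouten_bracket (B : multisec A -> multisec A -> multisec A) :
    Prop :=
  (forall P Q, smooth_multisec P -> smooth_multisec Q ->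
     smooth_multisec (B P Q)) /\
  (forall (k : R) P Q S,
     smooth_multisec P -> smooth_multisec Q -> smooth_multisec S ->
     B (k *: P + Q) S = k *: B P S + B Q S /\
     B S (k *: P + Q) = k *: B S P + B S Q) /\
  (forall X f, smooth_sec X -> smooth f ->
     B (of_sec X) (of_fun A f) = of_fun A (fun x => anchor (X x) f)) /\
  (forall X Y, smooth_sec X -> smooth_sec Y ->
     B (of_sec X) (of_sec Y) = of_sec (lbracket X Y)) /\
  (forall f g, smooth f -> smooth g -> B (of_fun A f) (of_fun A g) = 0) /\
  (forall (p q : nat) P Q, multisec_deg p P -> multisec_deg q Q ->
     B P Q = - (ksign R ((p%:Z - 1) * (q%:Z - 1)) *: B Q P)) /\
  (forall (p q : nat) P Q S,
     multisec_deg p P -> multisec_deg q Q -> smooth_multisec S ->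
     B P (wedge Q S) =
       wedge (B P Q) S + ksign R ((p%:Z - 1) * q%:Z) *: wedge Q (B P S)).

(* The binary form (-1)^(p-1) B P Q, where P has degree d = p - 2. *)
Definition l2_form (B : multisec A -> multisec A -> multisec A) :
    vform (multisec A) :=
  vform2 1 (fun P Q => ksign R (P.1 + 1) *: B P.2 Q.2).

End NijenhuisTensors.

(* Main.v *)
Require Import Defs.
From HB Require Import structures.
From mathcomp Require Import all_boot all_order all_algebra perm.
From mathcomp Require Import all_classical all_reals all_analysis.
From mathcomp Require Import ring zify ssrAC.

Set Implicit Arguments.
Unset Strict Implicit.
Unset Printing Implicit Defensive.
Import Order.TTheory GRing.Theory Num.Theory.
Import numFieldNormedType.Exports.
Local Open Scope classical_set_scope.
Local Open Scope ring_scope.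

(** Write [D] for the extension of [N] by derivation, [E] for that of [N \o N]
    and [B] for the Schouten bracket. Bracketing a symmetric binary form
    [(-1)^(p-1) F P Q] with [D] yields the binary form attached to the deformed
    bracket [F (D P) Q + F P (D Q) - D (F P Q)] ([RN_bracket_deformed]), so the
    equation to prove says that deforming [B] twice by [D] amounts to deforming
    it once by [E] ([deformed_square]).

    Because [D] is a derivation of the wedge product ([der_wedge]), deforming a
    graded biderivation of degree -1 gives a graded biderivation of degree -1
    ([deformed_biderivation]). Both sides are therefore biderivations, and it is
    enough to compare them on functions and on sections of [A]
    ([biderivation_eq]). On a section [X] and a function they are both given by
    the anchor of [N (N X)]; on two sections the difference is twice the
    Nijenhuis torsion of [N]. That the squared form commutes with [D] is checked
    in the same way on wedge products ([derivations_commute]).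

    All these reductions to generators are local, whereas the operators are only
    known on global sections. The passage is [locally_decomposable]: near any
    point a homogeneous multisection becomes, after multiplication by a smooth
    function equal to 1 at that point, a finite sum of functions times wedge
    products of global sections. It rests on a bump function supported in the
    domain of a trivialization ([bump_function]), built from the flat function
    [exp (- 1 / t)] and from the fact that compact sets are closed in a Hausdorff
    space, and on the grading of the exterior algebra ([ext_hpart]), which picks
    the coefficients of the right degree. Linearity over smooth functions,
    possibly modulo terms that are already controlled, then gives the induction
    principle [local_ind] used for derivations and biderivations alike. *)

(** * Closure properties of smooth maps on open sets *)

Section Calculus.
Variables (R : realType) (n : nat).
Implicit Types (U : set 'rV[R]_n) (W : normedModType R) (k : nat).

Lemma differentiable_near0 (V W : normedModType R) (z : V -> W) (x : V) :
  (\near x, z x = 0) -> differentiable z x.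
Proof.
move=> z0.
have zx : z x = 0 by exact: nbhs_singleton z0.
have zE : z \o shift x = cst (z x) + (\0 : V -> W) +o_ 0 id.
  apply/eqaddoP => e e0; rewrite zx.
  have : \forall y \near (0 : V), z (y + x) = 0.
    by move: z0; rewrite (near_shift 0) /= subr0.
  apply: filterS => y yz; rewrite !fctE /= yz addr0 subr0 normr0.
  by apply: mulr_ge0 => //; exact: ltW.
apply/diff_locallyP.
have c0 : continuous (\0 : V -> W) by move=> ?; exact: cvg_cst.
have -> : 'd z x = (\0 : V -> W) :> (V -> W).
  exact: (@diff_unique _ _ _ _ (\0 : {linear V -> W})).
by [].
Unshelve. all: by end_near. Qed.

(** Charts and trivializations are only meaningful on their domains, so
    smoothness has to be insensitive to the values taken elsewhere. *)
Lemma near_eq_differentiable (V W : normedModType R) (f g : V -> W) (x : V) :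
  (\near x, f x = g x) -> differentiable f x -> differentiable g x.
Proof.
move=> fg df; have -> : g = f + (g - f) by rewrite addrC subrK.
apply: differentiableD => //; apply: differentiable_near0.
by apply: filterS fg => y /= fgy; rewrite !fctE fgy subrr.
Qed.

Lemma open_eq_near U W (f g : 'rV[R]_n -> W) x : open U ->
  (forall y, U y -> f y = g y) -> U x -> \near x, f x = g x.
Proof. by move=> oU fg Ux; apply: filterS (open_nbhs_nbhs (conj oU Ux)). Qed.

Lemma Ck_on_eq k U W (f g : 'rV[R]_n -> W) : open U ->
  (forall x, U x -> f x = g x) -> Ck_on k U f -> Ck_on k U g.
Proof.
move=> oU; elim: k f g => [|k IH] f g fg /=.
  move=> cf x Ux; have fgx := open_eq_near oU fg Ux.
  suff: g @ x --> f x by rewrite (fg x Ux).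
  by apply: cvg_trans (cf x Ux); exact: near_eq_cvg fgx.
move=> [df Df]; split=> [x Ux|v].
  exact: near_eq_differentiable (open_eq_near oU fg Ux) (df x Ux).
apply: IH (Df v) => x Ux; apply: near_eq_derive.
exact: open_eq_near fg Ux.
Qed.

Lemma Ck_onU k U U' W (f : 'rV[R]_n -> W) :
  Ck_on k U f -> Ck_on k U' f -> Ck_on k (U `|` U') f.
Proof.
elim: k f => [|k IH] f /=; first by move=> fU fU' x [/fU|/fU'].
by move=> [fU dU] [fU' dU']; split=> [x [/fU|/fU']|v] //; apply: IH.
Qed.

Lemma Ck_on_sub k U U' W (f : 'rV[R]_n -> W) :
  U' `<=` U -> Ck_on k U f -> Ck_on k U' f.
Proof.
move=> UU'; elim: k f => [|k IH] f /=; first by move=> fU x /UU'/fU.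
by move=> [fU dU]; split=> [x /UU'/fU//|v]; apply: IH.
Qed.

Lemma Ck_onW k U W (f : 'rV[R]_n -> W) : Ck_on k.+1 U f -> Ck_on k U f.
Proof.
elim: k f => [|k IH] f /=.
  by move=> [df _] x Ux; apply/differentiable_continuous/df.
by move=> [df Df]; split=> // v; apply: IH; apply: Df.
Qed.

Lemma Ck_on_cst k U W (w : W) : Ck_on k U (cst w : 'rV[R]_n -> W).
Proof.
elim: k w => [|k IH] w /=; first by move=> x _; exact: cst_continuous.
split=> [x _|v]; first exact: differentiable_cst.
rewrite (_ : (fun x => _) = cst 0) //; apply/funext => x; exact: derive_cst.
Qed.

Lemma Ck_onD k U W (f g : 'rV[R]_n -> W) : open U ->
  Ck_on k U f -> Ck_on k U g -> Ck_on k U (fun x => f x + g x).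
Proof.
move=> oU; elim: k f g => [|k IH] f g /=.
  by move=> cf cg x Ux; apply: continuousD; [apply: cf|apply: cg].
move=> [df Df] [dg Dg]; split=> [x Ux|v].
  by apply: differentiableD; [apply: df|apply: dg].
apply: (Ck_on_eq oU _ (IH _ _ (Df v) (Dg v))) => x Ux.
by rewrite /= -deriveD //; apply: diff_derivable; [apply: df|apply: dg].
Qed.

Lemma Ck_onM k U (f g : 'rV[R]_n -> R^o) : open U ->
  Ck_on k U f -> Ck_on k U g -> Ck_on k U (fun x => f x * g x : R^o).
Proof.
move=> oU; elim: k f g => [|k IH] f g.
  by move=> cf cg x Ux; apply: continuousM; [apply: cf|apply: cg].
move=> fk gk; have f0 := Ck_onW fk; have g0 := Ck_onW gk.
case: fk gk => [df Df] [dg Dg]; split=> [x Ux|v].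
  by apply: differentiableM; [apply: df|apply: dg].
apply: (Ck_on_eq oU _ (Ck_onD oU (IH _ _ f0 (Dg v)) (IH _ _ g0 (Df v)))).
by move=> x Ux; rewrite /= -deriveM //; apply: diff_derivable; [apply: df|apply: dg].
Qed.

(** Taking a coordinate and scaling a fixed vector are continuous linear maps:
    this is how vector-valued maps reduce to their coordinates. *)
Lemma Ck_on_linear k U (W W' : normedModType R) (L : {linear W -> W'})
    (f : 'rV[R]_n -> W) : open U -> continuous L ->
  Ck_on k U f -> Ck_on k U (fun x => L (f x)).
Proof.
move=> oU cL; elim: k f => [|k IH] f.
  by move=> cf x Ux; apply: continuous_comp; [apply: cf|apply: cL].
case=> [df Df]; have dL y : differentiable L y by apply: linear_differentiable.
split=> [x Ux|v].
  exact: (differentiable_comp (df x Ux) (dL _)).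
apply: (Ck_on_eq oU _ (IH _ (Df v))) => x Ux.
rewrite !deriveE; [|exact: (differentiable_comp (df x Ux) (dL _))|exact: df].
by rewrite (diff_comp (df x Ux) (dL _)) /= diff_lin.
Qed.

Lemma Ck_on_coord k U m p (f : 'rV[R]_n -> 'M[R]_(m, p)) i j : open U ->
  Ck_on k U f -> Ck_on k U (fun x => f x i j : R^o).
Proof.
move=> oU fk.
have lin : linear (fun N : 'M[R]_(m, p) => N i j : R^o).
  by move=> a u v; rewrite !mxE.
pose linM := GRing.isLinear.Build _ _ _ _ _ lin.
pose L : {linear 'M[R]_(m, p) -> R^o} :=
  HB.pack (fun N : 'M[R]_(m, p) => N i j : R^o) linM.
by apply: (@Ck_on_linear _ _ _ _ L) => //; exact: coord_continuous.
Qed.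

Lemma Ck_onZl k U W (f : 'rV[R]_n -> R^o) (w : W) : open U ->
  Ck_on k U f -> Ck_on k U (fun x => f x *: w).
Proof.
move=> oU fk.
have lin : linear (fun a : R^o => (a : R) *: w).
  by move=> a u v; rewrite scalerDl scalerA.
pose linM := GRing.isLinear.Build _ _ _ _ _ lin.
pose L : {linear R^o -> W} := HB.pack (fun a : R^o => (a : R) *: w) linM.
by apply: (@Ck_on_linear _ _ _ _ L) => //; exact: scalel_continuous.
Qed.

End Calculus.

(** * A flat function *)

Section Flat.
Variable R : realType.

(** The derivative of [flat m] is [flat m.+2 - m * flat m.+1], so that this
    family is closed under differentiation and each of its members is smooth;
    [flat 0] is the usual function [exp (- 1 / t)]. *)
Definition flat (m : nat) (t : R) : R :=
  if 0 < t then t^-1 ^+ m * expR (- t^-1) else 0.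

Lemma flat_le0 m t : t <= 0 -> flat m t = 0.
Proof. by rewrite /flat leNgt => /negbTE ->. Qed.

Lemma flat_gt0 m t : 0 < t -> 0 < flat m t.
Proof. by move=> t0; rewrite /flat t0 mulr_gt0 ?expR_gt0 ?exprn_gt0 ?invr_gt0. Qed.

(** The term of degree [m + 2] of the exponential series bounds [expR t^-1]
    from below. *)
Lemma flat_bound m t : `|flat m t| <= (m.+2)`!%:R * t ^+ 2.
Proof.
case: (ltP 0 t) => [t0|t0]; last first.
  by rewrite flat_le0 // normr0 mulr_ge0 // sqr_ge0.
rewrite ger0_norm; last exact/ltW/flat_gt0.
rewrite /flat t0 expRN.
have s0 : 0 < t^-1 by rewrite invr_gt0.
have f0 : 0 < (m.+2)`!%:R :> R by rewrite ltr0n fact_gt0.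
have : t^-1 ^+ m.+2 / (m.+2)`!%:R <= expR t^-1.
  by apply: le_trans (expR_ge1Dxn m.+1 (ltW s0)); rewrite lerDr.
rewrite ler_pdivrMr // => H.
have -> : t^-1 ^+ m = t^-1 ^+ m.+2 * t ^+ 2.
  by rewrite !exprS expr0; field; rewrite gt_eqF.
rewrite ler_pdivrMr ?expR_gt0 // [leRHS]mulrAC [_%:R * expR _]mulrC.
by rewrite ler_wpM2r // sqr_ge0.
Qed.

Lemma is_derive_comp1 (f g : R -> R) (x df dg : R) :
  is_derive x (1 : R) g dg -> is_derive (g x) (1 : R) f df ->
  is_derive x (1 : R) (f \o g) (df * dg).
Proof.
move=> [gx <-] [fx <-]; split; last by rewrite -!derive1E derive1_comp.
by apply/derivable1_diffP/differentiable_comp; apply/derivable1_diffP.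
Qed.

Lemma is_derive_flat m t :
  is_derive t (1 : R) (flat m) (flat m.+2 t - m%:R * flat m.+1 t).
Proof.
case: (ltgtP t 0) => [t0|t0|->].
- rewrite !flat_le0 ?ltW // mulr0 subrr.
  apply: (@near_eq_is_derive _ _ _ (cst 0)).
  near=> s; rewrite flat_le0 //; near: s.
  by apply: filterS (lt_nbhsl t0) => s /= /ltW.
- apply: (@near_eq_is_derive R R^o R^o (fun s : R => s^-1 ^+ m * expR (- s^-1) : R)).
    near=> s; rewrite /flat ifT //; near: s.
    by apply: filterS (lt_nbhsr t0) => s.
  have tn0 : t != 0 by rewrite gt_eqF.
  have dV : is_derive t (1 : R) (fun s => s^-1) (- t^-1 ^+ 2).
    split; first exact: derivableV.
    by rewrite deriveV // derive_id /GRing.scale /= mulr1 exprVn.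
  have dE : is_derive t (1 : R) (fun s : R => expR (- s^-1))
     (t^-1 ^+ 2 * expR (- t^-1)).
    have d1 : is_derive t (1 : R) (fun s : R => - s^-1) (t^-1 ^+ 2).
      by have := @is_deriveN R R R _ _ _ _ dV; rewrite opprK.
    by have := is_derive_comp1 d1 (is_derive_expR _); rewrite mulrC.
  have dX : is_derive t (1 : R) (fun s => s^-1 ^+ m) (- (m%:R * t^-1 ^+ m.+1)).
    have := @is_deriveX _ _ _ m t 1 _ dV.
    rewrite exprfctE /GRing.scale /= => H; apply: is_derive_eq H _.
    by case: m => [|m]; rewrite ?mul0r ?oppr0 //= !exprS expr0; ring.
  have := is_deriveM dX dE.
  rewrite /GRing.scale /= => H; apply: is_derive_eq H _.
  by rewrite /flat t0 !exprS; ring.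
rewrite !flat_le0 // mulr0 subrr.
suff H : (fun h : R => h^-1 *: ((flat m (h *: (1 : R) + 0) - flat m 0) : R^o)) @ 0^' --> (0 : R^o).
  by split; [apply/cvg_ex; exists 0 | apply: cvg_lim H].
(* At 0 the difference quotient is bounded by a multiple of |h|. *)
apply/cvgrPdist_le => e e0.
have C0 : 0 < (m.+2)`!%:R :> R by rewrite ltr0n fact_gt0.
have : \forall h \near (0 : R)^', `|h| <= e / (m.+2)`!%:R.
  apply: nbhs_dnbhs; near=> h; near: h.
  have d0 : 0 < e / (m.+2)`!%:R by rewrite divr_gt0.
  have := @nbhs0_le R R^o _ d0.
  by [].
move=> H; near=> h.
have h0 : h != 0 by near: h; exact: nbhs_dnbhs_neq.
have he : `|h| <= e / (m.+2)`!%:R by near: h.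
rewrite sub0r normrN (flat_le0 m (lexx 0)) subr0 addr0 normrM normfV.
rewrite /GRing.scale /= mulr1 mulrC.
rewrite ler_pdivrMr ?normr_gt0 //.
apply: le_trans (flat_bound m h) _.
rewrite -[h ^+ 2]ger0_norm ?sqr_ge0 // normrX expr2 mulrA.
by rewrite ler_wpM2r // mulrC -ler_pdivlMr.
Unshelve. all: by end_near. Qed.

(** The induction on [k] has to be uniform in [m], as differentiating [flat m]
    brings in [flat m.+1] and [flat m.+2]. *)
Lemma Ck_on_flat n k m (U : set 'rV[R]_n) (h : 'rV[R]_n -> R^o) : open U ->
  Ck_on k U h -> Ck_on k U (fun x => flat m (h x) : R^o).
Proof.
move=> oU; have dflat p y : differentiable (flat p : R -> R) y.
  by apply/derivable1_diffP; have [] := is_derive_flat p y.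
elim: k m h => [|k IH] m h.
  move=> ch x Ux; apply: (@continuous_comp _ _ _ h (flat m)); first exact: ch.
  exact/differentiable_continuous/dflat.
move=> hk; have h0 := Ck_onW hk; case: hk => [dh Dh].
have dfh x : U x -> differentiable (flat m \o h) x.
  by move=> Ux; apply: differentiable_comp; [apply: dh|apply: dflat].
split=> [x /dfh //|v].
have H1 := Ck_onM oU (Ck_on_cst k U (- m%:R : R^o)) (IH m.+1 h h0).
have Hm := Ck_onM oU (Ck_onD oU (IH m.+2 h h0) H1) (Dh v).
apply: (Ck_on_eq oU _ Hm) => x Ux /=.
rewrite (deriveE _ (dfh x Ux)) (diff_comp (dh x Ux) (dflat _ _)) /=.
rewrite -(deriveE _ (dh x Ux)) -['D_v h x in RHS]mulr1 [RHS]linearZ /= mulrC.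
rewrite -(deriveE _ (dflat m (h x))).
by have [_ ->] := is_derive_flat m (h x); rewrite mulNr.
Qed.

End Flat.

(** * Smooth maps on a manifold and bump functions *)

Section SmoothMaps.
Variables (R : realType) (n : nat) (M : manifold R n).
Implicit Types (U T : set M) (W : normedModType R).

Lemma chart_image_openI i U : open U -> open (chart i @` (chart_dom i `&` U)).
Proof.
move=> oU; rewrite openE => _ [y [domy Uy] <-].
have imy : (chart i @` chart_dom i) (chart i y) by exists y.
have cU : \forall v \near chart i y, U (chart_inv i v).
  apply: (chart_inv_continuous imy); rewrite chartK //.
  by apply: open_nbhs_nbhs.
have cI : \forall v \near chart i y, (chart i @` chart_dom i) v.
  by apply: open_nbhs_nbhs; split => //; exact: chart_image_open.
rewrite /interior /=; near=> v.
have : (chart i @` chart_dom i) v by near: v.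
case=> z domz zv; exists z => //; split=> //.
have : U (chart_inv i v) by near: v.
by rewrite -zv chartK.
Unshelve. all: by end_near. Qed.

Lemma smooth_map_eq U W (f g : M -> W) : open U ->
  (forall x, U x -> f x = g x) -> smooth_map U f -> smooth_map U g.
Proof.
move=> oU fg sf i k; apply: Ck_on_eq (sf i k); first exact: chart_image_openI.
by move=> _ [x [domx Ux] <-] /=; rewrite chartK //; apply: fg.
Qed.

Lemma smooth_map_sub U T W (f : M -> W) :
  T `<=` U -> smooth_map U f -> smooth_map T f.
Proof.
move=> TU sf i k; apply: Ck_on_sub (sf i k).
by apply: image_subset => x [? /TU].
Qed.

Lemma smooth_map_cover T U V W (f : M -> W) : (forall x, U x \/ V x) ->
  smooth_map (T `&` U) f -> smooth_map (T `&` V) f -> smooth_map T f.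
Proof.
move=> UV fU fV i k; apply: Ck_on_sub (Ck_onU (fU i k) (fV i k)).
by move=> _ [x [domx Tx] <-]; case: (UV x) => ?; [left|right]; exists x.
Qed.

Lemma smooth_map_cst U W (w : W) : smooth_map U (fun=> w).
Proof. by move=> i k; exact: Ck_on_cst. Qed.

Lemma smooth_mapD U W (f g : M -> W) : open U ->
  smooth_map U f -> smooth_map U g -> smooth_map U (fun x => f x + g x).
Proof.
move=> oU sf sg i k.
exact: (Ck_onD (chart_image_openI oU) (sf i k) (sg i k)).
Qed.

Lemma smooth_mapM U (f g : M -> R) : open U ->
  smooth_map (W := R^o) U f -> smooth_map (W := R^o) U g ->
  smooth_map (W := R^o) U (fun x => f x * g x).
Proof.
move=> oU sf sg i k.
exact: (Ck_onM (chart_image_openI oU) (sf i k) (sg i k)).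
Qed.

Lemma smooth_mapX U (f : M -> R) m : open U ->
  smooth_map (W := R^o) U f -> smooth_map (W := R^o) U (fun x => f x ^+ m).
Proof.
move=> oU sf; elim: m => [|m IH]; first exact: smooth_map_cst.
apply: (@smooth_map_eq _ R^o (fun x => f x * f x ^+ m)) => //.
  by move=> x _; rewrite exprS.
exact: smooth_mapM.
Qed.

Lemma smooth_mapZl U W (f : M -> R) (w : W) : open U ->
  smooth_map (W := R^o) U f -> smooth_map U (fun x => f x *: w).
Proof.
by move=> oU sf i k; exact: (Ck_onZl w (chart_image_openI oU) (sf i k)).
Qed.

Lemma smooth_map_coord U m p (f : M -> 'M[R]_(m, p)) i j : open U ->
  smooth_map U f -> smooth_map (W := R^o) U (fun x => f x i j).
Proof.
by move=> oU sf l k; exact: (Ck_on_coord i j (chart_image_openI oU) (sf l k)).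
Qed.

Lemma smooth_map_sum U W (I : Type) (r : seq I) (P : pred I) (f : I -> M -> W) :
  open U -> (forall i, P i -> smooth_map U (f i)) ->
  smooth_map U (fun x => \sum_(i <- r | P i) f i x).
Proof.
move=> oU sf; elim: r => [|i r IH].
  by apply: (smooth_map_eq oU _ (smooth_map_cst U 0)) => x _; rewrite big_nil.
case Pi: (P i); last first.
  by apply: (smooth_map_eq oU _ IH) => x _; rewrite big_cons Pi.
apply: (smooth_map_eq oU _ (smooth_mapD oU (sf i Pi) IH)) => x _.
by rewrite big_cons Pi.
Qed.

Lemma smooth_map_row U p (f : M -> 'rV[R]_p) : open U ->
  (forall j, smooth_map (W := R^o) U (fun x => f x 0 j)) -> smooth_map U f.
Proof.
move=> oU sf.
apply: (@smooth_map_eq _ _ (fun x => \sum_j f x 0 j *: delta_mx 0 j)) => //.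
  by move=> x _; rewrite [RHS]row_sum_delta.
by apply: smooth_map_sum => // j _; exact: smooth_mapZl.
Qed.

Lemma smooth_mul (f g : M -> R) :
  smooth f -> smooth g -> smooth (fun x => f x * g x).
Proof. by apply: smooth_mapM; exact: openT. Qed.

Lemma smooth_cst (a : R) : smooth (fun _ : M => a).
Proof. exact: (@smooth_map_cst setT R^o). Qed.

(** In a chart the bump is [flat 0 (r ^+ 2 - |y - y0| ^+ 2)]. Its support is the
    image of a compact subset of the chart, hence closed in [M], which is
    Hausdorff; so the extension by zero is smooth, and vanishes on the open
    complement [V] of that support. *)
Lemma bump_function U (x0 : M) : open U -> U x0 ->
  exists f : M -> R, exists V : set M,
    [/\ smooth f, f x0 = 1, open V, forall x, V x -> f x = 0
      & forall x, U x \/ V x].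
Proof.
move=> oU Ux0; have [i domx0] := chart_cover x0.
set y0 := chart i x0.
have : nbhs y0 (chart i @` (chart_dom i `&` U)).
  by apply: open_nbhs_nbhs; split; [exact: chart_image_openI|exists x0].
move=> /nbhs_closedballP [r rU].
pose dist2 (y : 'rV[R]_n) : R := \sum_j (y 0 j - y0 0 j) ^+ 2.
pose K' : set 'rV[R]_n :=
  [set y | forall j, `[y0 0 j - r%:num, y0 0 j + r%:num]%classic (y ord0 j)].
have K'sub y : K' y -> (chart i @` (chart_dom i `&` U)) y.
  move=> Ky; apply: rU; rewrite closed_ballE //; rewrite /closed_ball_ /=.
  rewrite [leLHS]/Num.Def.normr /= mx_normrE bigmax_le // => -[a b] _ /=.
  rewrite !mxE (ord1 a) /=; have := Ky b; rewrite /= in_itv /= => /andP[h1 h2].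
  by rewrite ler_distlC h1 h2.
have K'c : compact K'.
  by apply: (@rV_compact R n (fun j => `[_, _]%classic)) => j; exact: segment_compact.
have K'far y : ~ K' y -> r%:num ^+ 2 - dist2 y <= 0.
  move=> nK; rewrite subr_le0 leNgt; apply/negP => lt; apply: nK => j /=.
  rewrite in_itv /= -ler_distlC -ler_sqr ?nnegrE // real_normK ?num_real //.
  rewrite -sqrrN opprB; apply: ltW; apply: le_lt_trans lt.
  rewrite /dist2 (bigD1 j) //= lerDl; apply: sumr_ge0 => ? _; exact: sqr_ge0.
pose K := chart_inv i @` K'.
have Kclosed : closed K.
  apply: compact_closed; first exact: manifold_hausdorff.
  apply: continuous_compact K'c; apply: continuous_in_subspaceT => y.
  rewrite inE => /K'sub [x [domx _] <-]; apply: chart_inv_continuous.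
  by exists x.
have Ksub x : K x -> chart_dom i x /\ U x.
  by move=> [y /K'sub [z [domz Uz] <-] <-]; rewrite chartK.
pose b (x : M) : R := flat 0 (r%:num ^+ 2 - dist2 (chart i x)).
pose f0 (x : M) : R := if `[< chart_dom i x >] then b x else 0.
have f0V x : (~` K) x -> f0 x = 0.
  rewrite /f0; case: asboolP => // domx nK; rewrite /b flat_le0 // K'far //.
  by move=> K'x; apply: nK; exists (chart i x) => //; rewrite chartK.
have f0x0 : 0 < f0 x0.
  rewrite /f0; case: asboolP => // _; apply: flat_gt0.
  rewrite /dist2 big1 ?subr0 ?exprn_gt0 // => j _.
  by rewrite subrr expr0n.
have oV : open (~` K) by rewrite openC.
have oD : open (setT `&` chart_dom i) by rewrite setTI; exact: chart_dom_open.
have sf0 : smooth f0.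
  apply: (@smooth_map_cover _ (chart_dom i) (~` K)).
  - move=> x; case: (pselect (K x)) => [/Ksub[]|]; [by left|by right].
  - apply: (@smooth_map_eq _ R^o b).
    + exact: oD.
    + by move=> x [_ domx]; rewrite /f0; case: asboolP.
    + move=> j k.
      apply: (@Ck_on_flat _ _ _ 0 _ (fun u => r%:num ^+ 2 - dist2 (chart i (chart_inv j u)))).
        exact: chart_image_openI.
      suff H : smooth_map (W := R^o) (setT `&` chart_dom i)
          (fun x => r%:num ^+ 2 - dist2 (chart i x)) by exact: (H j k).
      apply: (@smooth_map_eq (setT `&` chart_dom i) R^o
        (fun x => r%:num ^+ 2 + \sum_l (-1) * (chart i x 0 l + - y0 0 l) ^+ 2)) => //.
        by move=> x _; rewrite -mulr_sumr mulN1r.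
      apply: smooth_mapD => //; first exact: smooth_map_cst.
      apply: smooth_map_sum => // l _; apply: smooth_mapM => //.
        exact: smooth_map_cst.
      apply: smooth_mapX => //; apply: smooth_mapD => //; last exact: smooth_map_cst.
      apply: smooth_map_coord => // m.
      by rewrite setTI; exact: chart_smooth.
  - apply: (@smooth_map_eq _ R^o (fun=> 0)).
    + by apply: openI => //; exact: openT.
    + by move=> x [_ /f0V].
    + exact: smooth_map_cst.
exists (fun x => (f0 x0)^-1 * f0 x), (~` K); split=> //.
- exact: smooth_mul (smooth_cst _) sf0.
- by rewrite mulVf // gt_eqF.
- by move=> x /f0V ->; rewrite mulr0.
- by move=> x; case: (pselect (K x)) => [/Ksub[]|]; [left|right].
Qed.

End SmoothMaps.

(** * The exterior algebra *)

Section Exterior.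
Variables (R : comNzRingType) (V : lmodType R).
Implicit Types (u v : V) (x y z : ext V).

Lemma ext_pi0 : ext_pi (EScal V 0) = 0. Proof. by []. Qed.
Lemma ext_piD a b : ext_pi (EAdd a b) = ext_pi a + ext_pi b :> ext V.
Proof. by rewrite -ext_adddE. Qed.
Lemma ext_piM a b : ext_pi (EMul a b) = ext_pi a * ext_pi b :> ext V.
Proof. by rewrite -ext_muldE. Qed.
Lemma ext_pi_scal k : ext_pi (EScal V k) = k%:A.
Proof.
by rewrite /GRing.scale /= ext_scaledM; exact/esym/(mulr1 (ext_pi (EScal V k))).
Qed.

Lemma ext_inj_linear : linear (@ext_inj R V).
Proof.
move=> k u v; rewrite /ext_inj -[k *: ext_pi _]mulr_algl -ext_pi_scal.
by rewrite -ext_piM -ext_piD; apply/ext_piP/ext_vec.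
Qed.
HB.instance Definition _ := GRing.isLinear.Build R V (ext V) _ (@ext_inj R V)
  ext_inj_linear.

Lemma ext_inj_sqr v : ext_inj v * ext_inj v = 0.
Proof. by rewrite -ext_piM -ext_pi0; apply/ext_piP/ext_vec_sqr. Qed.

Lemma ext_inj_anti u v : ext_inj u * ext_inj v = - (ext_inj v * ext_inj u).
Proof.
have := ext_inj_sqr (u + v); rewrite raddfD mulrDl !mulrDr !ext_inj_sqr.
by rewrite add0r addr0 => /eqP; rewrite addr_eq0 => /eqP.
Qed.

(** The algebra morphism into [{poly ext V}] sending each vector [v] to
    [v * 'X] records degrees as exponents. *)
Fixpoint ext_grading (a : ext_expr V) : {poly ext V} :=
  match a with
  | EVec v => (ext_inj v)%:P * 'X
  | EScal k => (k%:A)%:P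
  | EAdd a b => ext_grading a + ext_grading b
  | EMul a b => ext_grading a * ext_grading b
  end.

Lemma ext_gradingP a b : ext_eq a b -> ext_grading a = ext_grading b.
Proof.
elim=> //= {a b}.
- by move=> b a c _ -> _ ->.
- by move=> a a' b b' _ -> _ ->.
- by move=> a a' b b' _ -> _ ->.
- by move=> *; rewrite addrA.
- by move=> *; rewrite addrC.
- by move=> *; rewrite scale0r add0r.
- by move=> *; rewrite scaleN1r polyCN mulN1r addNr scale0r.
- by move=> *; rewrite mulrA.
- by move=> *; rewrite scale1r mul1r.
- by move=> *; rewrite mulrDl.
- by move=> *; rewrite mulrDr.
- move=> k a; apply/polyP => i; rewrite coefCM coefMC.
  by rewrite -scalerAl -scalerAr mul1r mulr1.
- by move=> *; rewrite scalerDl polyCD.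
- by move=> *; rewrite -polyCM -scalerAl mul1r scalerA.
- move=> k u v; rewrite linearP polyCD mulrDl mulrA -polyCM.
  by rewrite -scalerAl mul1r.
- move=> v; rewrite mulrA -[_ * 'X * _]mulrA -commr_polyX mulrA -polyCM.
  by rewrite ext_inj_sqr scale0r polyC0 !mul0r.
Qed.

Definition ext_hpart (p : nat) x : ext V := (ext_grading (ext_repr x))`_p.

Lemma ext_hpart_pi p a : ext_hpart p (ext_pi a) = (ext_grading a)`_p.
Proof. by rewrite /ext_hpart (ext_gradingP (ext_repr_pi a)). Qed.

Lemma ext_hpart_linear p : linear (ext_hpart p).
Proof.
move=> k x y; rewrite -[x]ext_reprK -[y]ext_reprK.
rewrite -[k *: ext_pi _]mulr_algl -ext_pi_scal -ext_piM -ext_piD.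
by rewrite !ext_hpart_pi /= coefD coefCM -scalerAl mul1r.
Qed.
HB.instance Definition _ p := GRing.isLinear.Build R (ext V) (ext V) _
  (ext_hpart p) (ext_hpart_linear p).

Lemma ext_hpart_prod p q (v : 'I_q -> V) :
  ext_hpart p (\prod_(i < q) ext_inj (v i)) =
  if p == q then \prod_(i < q) ext_inj (v i) else 0.
Proof.
suff [a -> Ea] : exists2 a, \prod_(i < q) ext_inj (v i) = ext_pi a &
    ext_grading a = (\prod_(i < q) ext_inj (v i))%:P * 'X^q.
  rewrite ext_hpart_pi Ea coefMXn coefC.
  by have [//|qp|->] := ltngtP p q; rewrite ?subnn // subn_eq0 leqNgt qp.
elim: q v => [|q IH] v.
  by exists (EScal V 1); rewrite ?big_ord0 //= scale1r mul1r.
have [a Ha Ea] := IH (fun i => v (lift ord0 i)).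
exists (EMul (EVec (v ord0)) a); rewrite big_ord_recl.
  by rewrite ext_piM -Ha.
rewrite /= Ea polyCM exprS !mulrA; congr (_ * _).
by rewrite -!mulrA commr_polyX.
Qed.

(** Distinct degrees are independent: a sum of words lying in [ext_pow p] is the
    sum of its words of length [p]. *)
Lemma ext_hpart_pow p x : ext_pow p x -> ext_hpart p x = x.
Proof.
move=> [m [c [v ->]]]; rewrite linear_sum; apply: eq_bigr => k _.
by rewrite linearZ /= ext_hpart_prod eqxx.
Qed.

Lemma ext_pow_prod p (v : 'I_p -> V) : ext_pow p (\prod_(i < p) ext_inj (v i)).
Proof. by exists 1%N, (fun=> 1), (fun=> v); rewrite big_ord1 scale1r. Qed.

Lemma ext_pow0 p : ext_pow p (0 : ext V).
Proof. by exists 0%N, (fun=> 0), (fun _ _ => 0); rewrite big_ord0. Qed.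

Lemma ext_pow_lin p k x y : ext_pow p x -> ext_pow p y -> ext_pow p (k *: x + y).
Proof.
move=> [m [c [v ->]]] [m' [c' [v' ->]]].
exists (m + m')%N, (fun i : 'I_(m + m') => match fintype.split i with inl j => k * c j | inr j => c' j end).
exists (fun i : 'I_(m + m') => match fintype.split i with inl j => v j | inr j => v' j end).
rewrite big_split_ord scaler_sumr; congr (_ + _); apply: eq_bigr => i _.
  by rewrite -/(unsplit (inl i)) unsplitK scalerA.
by rewrite -/(unsplit (inr i)) unsplitK.
Qed.

Lemma ext_powZ p k x : ext_pow p x -> ext_pow p (k *: x).
Proof. by move=> px; rewrite -[_ *: _]addr0; apply: ext_pow_lin => //; apply: ext_pow0. Qed.

Lemma ext_powD p x y : ext_pow p x -> ext_pow p y -> ext_pow p (x + y).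
Proof. by move=> px py; rewrite -[x]scale1r; apply: ext_pow_lin. Qed.

Lemma ext_pow_sum p (I : Type) (r : seq I) (P : pred I) (x : I -> ext V) :
  (forall i, P i -> ext_pow p (x i)) -> ext_pow p (\sum_(i <- r | P i) x i).
Proof.
by move=> px; apply: big_ind => //; [exact: ext_pow0 | exact: ext_powD].
Qed.

Lemma ext_pow1 : ext_pow 0 (1 : ext V).
Proof.
by exists 1%N, (fun=> 1), (fun _ _ => 0); rewrite big_ord1 big_ord0 scale1r.
Qed.

Lemma ext_powM p q x y : ext_pow p x -> ext_pow q y -> ext_pow (p + q) (x * y).
Proof.
move=> [m [c [v ->]]] [m' [c' [v' ->]]].
rewrite mulr_suml; apply: ext_pow_sum => i _; rewrite mulr_sumr.
apply: ext_pow_sum => j _; rewrite -scalerAl -scalerAr; do 2 apply: ext_powZ.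
pose w (k : 'I_(p + q)) := match fintype.split k with inl a => v i a | inr b => v' j b end.
suff -> : (\prod_(a < p) ext_inj (v i a)) * (\prod_(b < q) ext_inj (v' j b)) =
          \prod_(k < p + q) ext_inj (w k) by exact: ext_pow_prod.
rewrite big_split_ord; congr (_ * _); apply: eq_bigr => k _.
  by rewrite /w -/(unsplit (inl k)) unsplitK.
by rewrite /w -/(unsplit (inr k)) unsplitK.
Qed.

End Exterior.

Lemma big_in_enum (T : Type) (idx : T) (op : T -> T -> T) (I : finType)
    (A : {pred I}) (F : I -> T) :
  \big[op/idx]_(i in A) F i = \big[op/idx]_(i <- enum A) F i.
Proof. by rewrite -[LHS]big_filter [index_enum I]unlock. Qed.

Section Words.
Variables (R : comNzRingType) (r : nat).
Implicit Types (l : seq 'I_r) (I J K : {set 'I_r}).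

Let ltI : rel 'I_r := fun i j => (i < j)%N.

(** The sign and the resulting word do not depend on the vectors: this
    uniformity is what keeps the coefficients of a product of sections smooth. *)
Lemma insert_word (j : 'I_r) l : sorted ltI l ->
  exists (s : R) l', [/\ sorted ltI l', {subset l' <= j :: l} &
    forall (V : lmodType R) (v : 'I_r -> V),
      ext_inj (v j) * \prod_(i <- l) ext_inj (v i) =
      s *: \prod_(i <- l') ext_inj (v i)].
Proof.
elim: l => [|k l IH] sl.
  by exists 1, [:: j]; split=> // V v; rewrite scale1r !big_seq1 big_nil mulr1.
have [jk|kj|jk] := ltngtP j k.
- exists 1, [:: j, k & l]; split=> //; first by apply/andP; split.
  by move=> V v; rewrite scale1r !big_cons.
- have sl' : sorted ltI l by exact: path_sorted sl.
  have [s [l' [sl'' sub E]]] := IH sl'.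
  exists (- s), (k :: l'); split.
  + rewrite /= path_min_sorted //; apply/allP => i /sub.
    rewrite inE => /orP[/eqP -> //|il].
    have tr : transitive ltI by move=> a b c; exact: ltn_trans.
    by have /allP := order_path_min tr sl; apply.
  + move=> i; rewrite !inE => /orP[->|/sub]; first by rewrite orbT.
    by rewrite inE => /orP[->|->]; rewrite ?orbT.
  + move=> V v; rewrite !big_cons mulrA ext_inj_anti mulNr -mulrA E.
    by rewrite -scalerAr scaleNr.
- exists 0, [::]; split=> // V v.
  by rewrite big_cons mulrA (val_inj jk) ext_inj_sqr mul0r scale0r.
Qed.

Lemma sorted_word_set l : sorted ltI l -> exists I,
  forall (V : lmodType R) (v : 'I_r -> V),
    \prod_(i <- l) ext_inj (v i) = \prod_(i in I) ext_inj (v i).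
Proof.
move=> sl; exists [set i in l] => V v; rewrite big_in_enum.
congr (\big[*%R/1]_(i <- _) _).
have tr : transitive ltI by move=> a b c; exact: ltn_trans.
have irr : irreflexive ltI by move=> a; exact: ltnn.
apply: (irr_sorted_eq tr irr) => //.
  have se : sorted ltI (enum 'I_r).
    have : sorted ltn (map val (enum 'I_r)) by rewrite val_enum_ord iota_ltn_sorted.
    by rewrite sorted_map.
  by rewrite /(enum [set i in l]) /enum_mem -enumT; exact: sorted_filter.
by move=> i; rewrite mem_enum inE.
Qed.

Lemma word_set l : exists (s : R) I,
  forall (V : lmodType R) (v : 'I_r -> V),
    \prod_(i <- l) ext_inj (v i) = s *: \prod_(i in I) ext_inj (v i).
Proof.
suff [s [l' [sl' E]]] : exists (s : R) l', sorted ltI l' /\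
  forall (V : lmodType R) (v : 'I_r -> V),
    \prod_(i <- l) ext_inj (v i) = s *: \prod_(i <- l') ext_inj (v i).
  have [I EI] := sorted_word_set sl'.
  by exists s, I => V v; rewrite E EI.
elim: l => [|j l [s [l' [sl' E]]]].
  by exists 1, [::]; split=> // V v; rewrite scale1r.
have [s' [l'' [sl'' _ E']]] := insert_word j sl'.
exists (s * s'), l''; split=> // V v.
by rewrite big_cons E -scalerAr E' scalerA.
Qed.

Lemma mul_set_words I J : exists (s : R) K,
  forall (V : lmodType R) (v : 'I_r -> V),
    (\prod_(i in I) ext_inj (v i)) * (\prod_(i in J) ext_inj (v i)) =
    s *: \prod_(i in K) ext_inj (v i).
Proof.
have [s [K E]] := word_set (enum I ++ enum J).
by exists s, K => V v; rewrite -E big_cat !big_in_enum.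
Qed.

End Words.

Lemma ext_hpart_set (R : comNzRingType) (V : lmodType R) p r (v : 'I_r -> V)
    (I : {set 'I_r}) :
  ext_hpart p (\prod_(j in I) ext_inj (v j)) =
  if p == #|I| then \prod_(j in I) ext_inj (v j) else 0.
Proof.
by rewrite big_in_enum big_tnth ext_hpart_prod cardE.
Qed.

(** * Multisections *)

Section Multisections.
Variables (R : realType) (n : nat) (M : manifold R n) (A : vbundle M).
Implicit Types (P Q S : multisec A) (X Y : sec (fiber A)) (f g : M -> R).

Lemma smooth_on_triv f a : smooth f -> smooth_map (W := R^o) (@triv_dom R n M A a) f.
Proof. exact: smooth_map_sub. Qed.

Lemma smooth_sec_lin f X Y :
  smooth f -> smooth_sec X -> smooth_sec Y -> smooth_sec (fscale f X + Y).
Proof.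
move=> sf sX sY a; have oU := triv_dom_open a.
apply: smooth_map_row => // j.
apply: (@smooth_map_eq _ _ _ _ R^o
  (fun x => f x * triv a x (X x) 0 j + triv a x (Y x) 0 j)) => //.
  by move=> x _; rewrite linearP !mxE.
apply: smooth_mapD => //; last exact: smooth_map_coord.
by apply: smooth_mapM => //; [exact: smooth_on_triv|exact: smooth_map_coord].
Qed.

Lemma smooth_sec0 : smooth_sec (0 : sec (fiber A)).
Proof.
move=> a; apply: (smooth_map_eq _ _ (smooth_map_cst _ 0)); first exact: triv_dom_open.
by move=> x _; rewrite [RHS]linear0.
Qed.

Lemma smooth_secD X Y : smooth_sec X -> smooth_sec Y -> smooth_sec (X + Y).
Proof.
move=> sX sY; rewrite (_ : X = fscale (fun=> 1) X).
  by apply: smooth_sec_lin => //; exact: smooth_cst.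
by apply: functional_extensionality_dep => x; rewrite /fscale scale1r.
Qed.

Lemma smooth_secN X : smooth_sec X -> smooth_sec (- X).
Proof.
move=> sX; rewrite (_ : - X = fscale (fun=> -1) X + 0).
  by apply: smooth_sec_lin => //; [exact: smooth_cst|exact: smooth_sec0].
by rewrite addr0; apply: functional_extensionality_dep => x; rewrite /fscale scaleN1r.
Qed.

Lemma triv_frame (a : triv_index A) j x : triv_dom a x ->
  triv a x (frame a j x) = delta_mx 0 j.
Proof.
move=> /triv_bij [h _ hK]; rewrite /frame; case: xgetP => [v _ //|].
by move=> /(_ (h (delta_mx 0 j))) /=; rewrite hK.
Qed.

Lemma sec_frameE (a : triv_index A) X x : triv_dom a x ->
  X x = \sum_j triv a x (X x) 0 j *: frame a j x.
Proof.
move=> ax; have [h hK _] := triv_bij ax; apply: (can_inj hK).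
rewrite linear_sum /= [LHS]row_sum_delta; apply: eq_bigr => j _.
by rewrite linearZ /= triv_frame.
Qed.

Let word (a : triv_index A) (I : {set 'I_(rank A)}) x : ext (fiber A x) :=
  \prod_(j in I) ext_inj (frame a j x).

Lemma smooth_of_fun f : smooth f -> smooth_multisec (of_fun A f).
Proof.
move=> sf a; have oU := triv_dom_open a.
exists (fun (I : {set _}) x => if I == finset.set0 then f x else 0).
  by move=> I; case: eqP => _; [exact: smooth_on_triv|exact: smooth_map_cst].
move=> x ax; rewrite (bigD1 finset.set0) //= eqxx finset.big_set0 big1 ?addr0 //.
by move=> I /negbTE ->; rewrite scale0r.
Qed.

Lemma smooth_of_sec X : smooth_sec X -> smooth_multisec (of_sec X).
Proof.
move=> sX a; have oU := triv_dom_open a.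
exists (fun (I : {set _}) x => \sum_j if I == finset.set1 j then triv a x (X x) 0 j else 0).
  move=> I; apply: smooth_map_sum => // j _; case: eqP => _.
    exact: smooth_map_coord.
  exact: smooth_map_cst.
move=> x ax; rewrite /of_sec {1}(sec_frameE X ax) linear_sum /=.
under [RHS]eq_bigr do rewrite scaler_suml.
rewrite exchange_big; apply: eq_bigr => j _ /=.
rewrite (bigD1 (finset.set1 j)) //= eqxx finset.big_set1 big1 ?addr0; first by rewrite linearZ.
by move=> I /negbTE ->; rewrite scale0r.
Qed.

Lemma smooth_multisec_lin f P Q : smooth f ->
  smooth_multisec P -> smooth_multisec Q -> smooth_multisec (fscale f P + Q).
Proof.
move=> sf sP sQ a; have oU := triv_dom_open a.
have [c sc Pc] := sP a; have [d sd Qd] := sQ a.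
exists (fun I x => f x * c I x + d I x).
  move=> I; apply: smooth_mapD => //.
  by apply: smooth_mapM => //; exact: smooth_on_triv.
move=> x ax; rewrite -[LHS]/(f x *: P x + Q x) (Pc x ax) (Qd x ax) scaler_sumr.
by rewrite -big_split; apply: eq_bigr => I _; rewrite scalerDl scalerA.
Qed.

(** Products of words in a local frame have constant structure coefficients. *)
Lemma smooth_wedge P Q :
  smooth_multisec P -> smooth_multisec Q -> smooth_multisec (wedge P Q).
Proof.
move=> sP sQ a; have oU := triv_dom_open a.
have [c sc Pc] := sP a; have [d sd Qd] := sQ a.
pose T := {set 'I_(rank A)}.
have /choice[sK sKE] : forall IJ : T * T, exists sK : R * T,
    forall (V : lmodType R) (v : 'I_(rank A) -> V),
    (\prod_(i in IJ.1) ext_inj (v i)) * (\prod_(i in IJ.2) ext_inj (v i)) =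
    sK.1 *: \prod_(i in sK.2) ext_inj (v i).
  by move=> IJ; have [s [K E]] := mul_set_words R IJ.1 IJ.2; exists (s, K).
exists (fun K x => \sum_(IJ : T * T)
    if (sK IJ).2 == K then (sK IJ).1 * (c IJ.1 x * d IJ.2 x) else 0).
  move=> K; apply: smooth_map_sum => // IJ _; case: eqP => _.
    by apply: smooth_mapM => //; [exact: smooth_map_cst|exact: smooth_mapM].
  exact: smooth_map_cst.
move=> x ax; rewrite /wedge (Pc x ax) (Qd x ax) mulr_suml.
under eq_bigr do rewrite mulr_sumr.
rewrite pair_big /=; under [RHS]eq_bigr do rewrite scaler_suml.
rewrite exchange_big; apply: eq_bigr => IJ _ /=.
rewrite (bigD1 (sK IJ).2) //= eqxx [X in _ + X]big1 ?addr0 => [|K].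
  by rewrite -scalerAl -scalerAr sKE !scalerA; congr (_ *: _); ring.
by rewrite eq_sym => /negbTE ->; rewrite scale0r.
Qed.

Lemma multisec_ext P Q : (forall x, P x = Q x) -> P = Q.
Proof. exact: functional_extensionality_dep. Qed.

Lemma sum_apply x (I : Type) (r : seq I) (p : pred I) (F : I -> multisec A) :
  (\sum_(i <- r | p i) F i) x = \sum_(i <- r | p i) F i x.
Proof.
elim: r => [|i r IH]; first by rewrite !big_nil.
by rewrite !big_cons; case: (p i) => //; rewrite -IH.
Qed.

Lemma fscale1 P : fscale (fun=> 1) P = P.
Proof. by apply: multisec_ext => x; rewrite /fscale scale1r. Qed.

Lemma fscale_cst k P : fscale (fun=> k) P = k *: P.
Proof. by []. Qed.

Lemma wedge_fun f P : wedge (of_fun A f) P = fscale f P.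
Proof. by apply: multisec_ext => x; rewrite /wedge /of_fun mulr_algl. Qed.

Lemma wedgeA P Q S : wedge P (wedge Q S) = wedge (wedge P Q) S.
Proof. by apply: multisec_ext => x; rewrite /wedge mulrA. Qed.

Lemma wedge_linl f P Q S :
  wedge (fscale f P + Q) S = fscale f (wedge P S) + wedge Q S.
Proof.
by apply: multisec_ext => x; rewrite /wedge [LHS]mulrDl /fscale -scalerAl.
Qed.

Lemma wedge_linr f P Q S :
  wedge P (fscale f Q + S) = fscale f (wedge P Q) + wedge P S.
Proof.
by apply: multisec_ext => x; rewrite /wedge [LHS]mulrDr /fscale -scalerAr.
Qed.

Lemma wedgeDl P Q S : wedge (P + Q) S = wedge P S + wedge Q S.
Proof. by rewrite -[P]fscale1 wedge_linl !fscale1. Qed.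

Lemma wedgeDr P Q S : wedge P (Q + S) = wedge P Q + wedge P S.
Proof. by rewrite -[Q]fscale1 wedge_linr !fscale1. Qed.

Lemma wedgeBl P Q S : wedge (P - Q) S = wedge P S - wedge Q S.
Proof. by apply: multisec_ext => x; rewrite /wedge -[RHS]mulrBl. Qed.

Lemma wedgeBr P Q S : wedge P (Q - S) = wedge P Q - wedge P S.
Proof. by apply: multisec_ext => x; rewrite /wedge -[RHS]mulrBr. Qed.

Lemma wedge_prod0 (X : 'I_0 -> sec (fiber A)) :
  wedge_prod X = of_fun A (fun=> 1).
Proof.
by apply: multisec_ext => x; rewrite /wedge_prod big_ord0 /of_fun scale1r.
Qed.

Lemma wedge_prodS p (X : 'I_p.+1 -> sec (fiber A)) :
  wedge_prod X = wedge (of_sec (X ord0)) (wedge_prod (fun i => X (lift ord0 i))).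
Proof. by apply: multisec_ext => x; rewrite /wedge_prod big_ord_recl. Qed.

Lemma deg_smooth p P : multisec_deg p P -> smooth_multisec P.
Proof. by case. Qed.

Lemma smooth_multisecD P Q :
  smooth_multisec P -> smooth_multisec Q -> smooth_multisec (P + Q).
Proof.
by move=> sP sQ; rewrite -[P]fscale1; apply: smooth_multisec_lin => //;
  exact: smooth_cst.
Qed.

Lemma smooth_multisecB P Q :
  smooth_multisec P -> smooth_multisec Q -> smooth_multisec (P - Q).
Proof.
move=> sP sQ; rewrite addrC -scaleN1r -fscale_cst.
by apply: smooth_multisec_lin => //; exact: smooth_cst.
Qed.

Lemma deg_of_fun f : smooth f -> multisec_deg 0 (of_fun A f).
Proof.
move=> sf; split; first exact: smooth_of_fun.
by move=> x; apply: ext_powZ; exact: ext_pow1.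
Qed.

Lemma deg_lin p f P Q : smooth f -> multisec_deg p P -> multisec_deg p Q ->
  multisec_deg p (fscale f P + Q).
Proof.
move=> sf [sP dP] [sQ dQ]; split; first exact: smooth_multisec_lin.
by move=> x; exact: ext_pow_lin.
Qed.

Lemma deg0 p : multisec_deg p (0 : multisec A).
Proof.
split; last by move=> x; exact: ext_pow0.
have -> : 0 = of_fun A (fun=> 0); last exact/smooth_of_fun/smooth_cst.
by apply: multisec_ext => x; rewrite /of_fun scale0r.
Qed.

Lemma smooth_multisec0 : smooth_multisec (0 : multisec A).
Proof. exact: deg_smooth (deg0 0). Qed.

Lemma degZl p f P : smooth f -> multisec_deg p P -> multisec_deg p (fscale f P).
Proof. by move=> sf dP; rewrite -[fscale _ _]addr0; apply: deg_lin => //; exact: deg0. Qed.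

Lemma degZ p k P : multisec_deg p P -> multisec_deg p (k *: P).
Proof. by apply: degZl; exact: smooth_cst. Qed.

Lemma degD p P Q : multisec_deg p P -> multisec_deg p Q -> multisec_deg p (P + Q).
Proof. by move=> dP dQ; rewrite -[P]fscale1; apply: deg_lin => //; exact: smooth_cst. Qed.

Lemma deg_wedge p q P Q : multisec_deg p P -> multisec_deg q Q ->
  multisec_deg (p + q) (wedge P Q).
Proof.
move=> [sP dP] [sQ dQ]; split; first exact: smooth_wedge.
by move=> x; exact: ext_powM.
Qed.

Lemma deg_of_sec X : smooth_sec X -> multisec_deg 1 (of_sec X).
Proof.
move=> sX; split; first exact: smooth_of_sec.
move=> x; have := ext_pow_prod (p := 1) (fun=> X x).
by rewrite big_ord1.
Qed.

Lemma deg_wedge_prod p (X : 'I_p -> sec (fiber A)) :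
  (forall i, smooth_sec (X i)) -> multisec_deg p (wedge_prod X).
Proof.
elim: p X => [|p IH] X sX.
  by rewrite wedge_prod0; apply: deg_of_fun; exact: smooth_cst.
rewrite wedge_prodS; apply: (@deg_wedge 1 p); first exact: deg_of_sec.
exact: IH.
Qed.

(** The shape of the second constructor is that of the linearity over smooth
    functions satisfied by the operators below. *)
Inductive decomposable (p : nat) : multisec A -> Prop :=
| decomposable0 : decomposable p 0
| decomposable_lin f (X : 'I_p -> sec (fiber A)) P :
    smooth f -> (forall i, smooth_sec (X i)) -> decomposable p P ->
    decomposable p (fscale f (wedge_prod X) + P).

Lemma deg_decomposable p P : decomposable p P -> multisec_deg p P.
Proof.
elim=> [|f X Q sf sX _ dQ]; first exact: deg0.
by apply: deg_lin => //; exact: deg_wedge_prod.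
Qed.

Lemma decomposableD p P Q :
  decomposable p P -> decomposable p Q -> decomposable p (P + Q).
Proof.
by move=> dP dQ; elim: dP => [|f X S sf sX _ IH];
  rewrite ?add0r // -addrA; exact: decomposable_lin.
Qed.

Lemma word_wedge_prod (a : triv_index A) f (I : {set 'I_(rank A)}) p :
  #|I| = p -> (forall j, smooth_sec (fscale f (frame a j))) ->
  exists2 X : 'I_p -> sec (fiber A), forall i, smooth_sec (X i) &
    forall x, wedge_prod X x = f x ^+ p *: word a I x.
Proof.
rewrite cardE => <- sf.
exists (fun i => fscale f (frame a (tnth (in_tuple (enum I)) i))) => // x.
rewrite /wedge_prod /word big_in_enum big_tnth.
elim: (size _) (tnth _) => [|m IH] t; first by rewrite !big_ord0 expr0 scale1r.
rewrite !big_ord_recl (IH (fun i => t (lift ord0 i))) linearZ /=.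
by rewrite -scalerAl -scalerAr scalerA exprS.
Qed.

(** A bump function supported in the domain of a trivialization extends the
    local frame and the coefficients to global smooth objects, at the price of
    multiplying the multisection by a power of that function. *)
Lemma locally_decomposable p P (x0 : M) : multisec_deg p P ->
  exists g, [/\ smooth g, g x0 = 1 & decomposable p (fscale g P)].
Proof.
move=> [sP dP]; have [a ax0] := triv_cover A x0; have oU := triv_dom_open a.
have [f [V [sf f1 oV f0 UV]]] := bump_function oU ax0.
have [c sc Pc] := sP a.
have sext (h : M -> R) : smooth_map (W := R^o) (triv_dom a) h ->
    smooth (fun x => f x * h x).
  move=> sh; apply: (@smooth_map_cover _ _ _ setT _ _ _ _ UV); rewrite setTI.
    by apply: smooth_mapM => //; exact: smooth_on_triv.
  apply: (smooth_map_eq oV _ (smooth_map_cst V (0 : R^o))) => x /f0 ->.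
  by rewrite mul0r.
have sframe j : smooth_sec (fscale f (frame a j)).
  move=> b; have ob := triv_dom_open b.
  apply: (@smooth_map_cover _ _ _ _ _ _ _ _ UV).
    have [g sg gE] := triv_smooth a b.
    have oab := openI oU ob; rewrite setIC.
    apply: smooth_map_row => // k.
    apply: (@smooth_map_eq _ _ _ _ R^o (fun x => f x * g x j k)) => //.
      move=> x [ax bx]; rewrite /fscale linearZ /= gE // triv_frame //.
      by rewrite -rowE !mxE.
    apply: smooth_mapM => //; last exact: smooth_map_coord.
    by apply: smooth_map_sub sf.
  apply: (smooth_map_eq (openI ob oV) _ (smooth_map_cst _ 0)) => x [_ /f0 fx].
  by rewrite /fscale fx scale0r linear0.
(* One factor [f] extends the coefficient and [p] others extend the frame. *)
exists (fun x => f x ^+ p.+1); split; first by apply: smooth_mapX; [exact: openT|].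
  by rewrite f1 expr1n.
pose term (I : {set 'I_(rank A)}) : multisec A :=
  fun x => (f x * c I x) *: (f x ^+ p *: word a I x).
have -> : fscale (fun x => f x ^+ p.+1) P =
    \sum_(I : {set 'I_(rank A)} | #|I| == p) term I.
  apply: multisec_ext => x; rewrite [RHS](sum_apply x) /fscale.
  case: (pselect (triv_dom a x)) => ax; last first.
    have fx0 : f x = 0 by case: (UV x) => // /f0.
    by rewrite fx0 expr0n scale0r big1 // => I _; rewrite /term fx0 mul0r scale0r.
  rewrite -(ext_hpart_pow (dP x)) (Pc x ax) linear_sum /= scaler_sumr.
  rewrite [RHS]big_mkcond; apply: eq_bigr => I _; rewrite linearZ /= ext_hpart_set.
  rewrite eq_sym; case: eqP => _; last by rewrite !scaler0.
  by rewrite /term !scalerA exprS; congr (_ *: _); ring.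
apply: big_ind => [||I /eqP cI]; [exact: decomposable0|exact: decomposableD|].
have [X sX XE] := word_wedge_prod cI sframe.
have -> : term I = fscale (fun x => f x * c I x) (wedge_prod X) + 0.
  by rewrite addr0; apply: multisec_ext => x; rewrite /fscale XE.
apply: decomposable_lin; [exact: sext|exact: sX|exact: decomposable0].
Qed.

End Multisections.

Arguments smooth_multisec0 {R n M} A.

(** * Derivations of the exterior algebra of sections *)

Section LocalInduction.
Variables (R : realType) (n : nat) (M : manifold R n) (A : vbundle M).
Implicit Types (P Q S : multisec A) (X Y : sec (fiber A)) (f g : M -> R).

(** Rescaling by a smooth function equal to 1 at the given point makes the
    multisection decomposable and, by linearity over functions modulo [T], does
    not change the class modulo [T] of the value of [F] there. *)
Lemma local_ind p (F : multisec A -> multisec A)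
    (T : forall x, ext (fiber A x) -> Prop) :
  (forall x, T x 0) ->
  (forall x (k : R) u v, T x u -> T x v -> T x (k *: u + v)) ->
  (forall f P Q x, smooth f -> multisec_deg p P -> multisec_deg p Q ->
     T x (F (fscale f P + Q) x - (f x *: F P x + F Q x))) ->
  (forall (X : 'I_p -> sec (fiber A)) x, (forall i, smooth_sec (X i)) ->
     T x (F (wedge_prod X) x)) ->
  forall P x, multisec_deg p P -> T x (F P x).
Proof.
move=> T0 Tlin FT FX P x dP.
have TD u v : T x u -> T x v -> T x (u + v).
  by move=> Tu Tv; rewrite -[u]scale1r; apply: Tlin.
have TN u : T x u -> T x (- u).
  by move=> Tu; rewrite -scaleN1r -[_ *: _]addr0; apply: Tlin.
have F0 : T x (F 0 x).
  have := FT (fun=> 1) 0 0 x (smooth_cst 1) (deg0 _ _) (deg0 _ _).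
  by rewrite fscale1 addr0 scale1r opprD addrA subrr sub0r => /TN; rewrite opprK.
have Fdec Q : decomposable p Q -> T x (F Q x).
  elim=> [//|f X S sf sX /deg_decomposable dS TS].
  have := FT f _ S x sf (deg_wedge_prod sX) dS.
  by move/TD => /(_ _ (Tlin _ (f x) _ _ (FX X x sX) TS)); rewrite subrK.
have [g [sg g1 gP]] := locally_decomposable x dP.
have := FT g P 0 x sg dP (deg0 _ _).
rewrite addr0 g1 scale1r => /TN /TD /(_ (Fdec _ gP)).
by rewrite opprB subrK => /TD /(_ (TN _ F0)); rewrite addrK.
Qed.

Definition fun_linear p (F : multisec A -> multisec A) :=
  forall f P Q, smooth f -> multisec_deg p P -> multisec_deg p Q ->
    F (fscale f P + Q) = fscale f (F P) + F Q.

Lemma fun_linear_eq p (F G : multisec A -> multisec A) :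
  fun_linear p F -> fun_linear p G ->
  (forall X : 'I_p -> sec (fiber A), (forall i, smooth_sec (X i)) ->
    F (wedge_prod X) = G (wedge_prod X)) ->
  forall P, multisec_deg p P -> F P = G P.
Proof.
move=> Flin Glin FG P dP; apply: multisec_ext => x; apply/eqP; rewrite -subr_eq0.
apply/eqP; apply: (@local_ind p (fun Q => F Q - G Q) (fun _ u => u = 0)) => //.
- by move=> y k u v -> ->; rewrite scaler0 addr0.
- move=> f Q S y sf dQ dS; rewrite Flin // Glin // -[LHS]/(
    f y *: F Q y + F S y - (f y *: G Q y + G S y)
      - (f y *: (F Q y - G Q y) + (F S y - G S y))).
  by rewrite scalerBr [- (f y *: G Q y + _)]opprD addrACA subrr.
- by move=> X y sX; rewrite FG // subrr.
Qed.

End LocalInduction.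

Section Derivations.
Variables (R : realType) (n : nat) (M : manifold R n) (A : lie_algebroid M).
Variables (N : sec (fiber A) -> sec (fiber A)) (D : multisec A -> multisec A).
Hypothesis N_smooth : forall X, smooth_sec X -> smooth_sec (N X).
Hypothesis D_ext : derivation_extension N D.
Implicit Types (P Q S : multisec A) (X Y : sec (fiber A)) (f g : M -> R).

Lemma der_smooth P : smooth_multisec P -> smooth_multisec (D P).
Proof. by have [H _ _ _] := D_ext; apply: H. Qed.

Lemma der_lin f P Q : smooth f -> smooth_multisec P -> smooth_multisec Q ->
  D (fscale f P + Q) = fscale f (D P) + D Q.
Proof. by have [_ H _ _] := D_ext; apply: H. Qed.

Lemma der_of_fun f : smooth f -> D (of_fun A f) = 0.
Proof. by have [_ _ H _] := D_ext; apply: H. Qed.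

Lemma der_fun_linear p : fun_linear p D.
Proof. by move=> f P Q sf /deg_smooth sP /deg_smooth sQ; exact: der_lin. Qed.

Lemma wedge_prod1 X : of_sec X = wedge_prod (fun _ : 'I_1 => X).
Proof. by apply: multisec_ext => x; rewrite /wedge_prod big_ord1. Qed.

Lemma der_of_sec X : smooth_sec X -> D (of_sec X) = of_sec (N X).
Proof.
move=> sX; rewrite wedge_prod1; have [_ _ _ ->] // := D_ext.
rewrite big_ord1 wedge_prod1; congr wedge_prod.
by apply/funext => j; rewrite ord1 eqxx.
Qed.

Lemma der_wedge_prodS p (X : 'I_p.+1 -> sec (fiber A)) :
  (forall i, smooth_sec (X i)) ->
  let X' := fun i => X (lift ord0 i) in
  D (wedge_prod X) = wedge (of_sec (N (X ord0))) (wedge_prod X') +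
                     wedge (of_sec (X ord0)) (D (wedge_prod X')).
Proof.
move=> sX X'; have [_ _ _ DX] := D_ext; rewrite DX // DX; last by move=> i; exact: sX.
rewrite big_ord_recl; congr (_ + _).
  by rewrite wedge_prodS eqxx.
apply: multisec_ext => x; rewrite /wedge !sum_apply mulr_sumr.
by apply: eq_bigr => i _; rewrite wedge_prodS /wedge /=; congr (_ * _).
Qed.

(** The values on wedge products only give this rule for wedge products [Q]; the
    general case follows by locality. *)
Lemma der_wedge_sec p Y Q : smooth_sec Y -> multisec_deg p Q ->
  D (wedge (of_sec Y) Q) = wedge (of_sec (N Y)) Q + wedge (of_sec Y) (D Q).
Proof.
move=> sY; have sY' := smooth_of_sec sY; have sNY := smooth_of_sec (N_smooth sY).
apply: (@fun_linear_eq _ _ _ _ _ (fun Q => D (wedge (of_sec Y) Q))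
  (fun Q => wedge (of_sec (N Y)) Q + wedge (of_sec Y) (D Q))).
- move=> f P S sf /deg_smooth sP /deg_smooth sS.
  by rewrite wedge_linr der_lin //; exact: smooth_wedge.
- move=> f P S sf /deg_smooth sP /deg_smooth sS.
  rewrite der_lin // !wedge_linr; apply: multisec_ext => x.
  by rewrite [LHS]addrACA /fscale -scalerDr.
- move=> X sX; pose Z (i : 'I_p.+1) := if unlift ord0 i is Some j then X j else Y.
  have Z0 : Z ord0 = Y by rewrite /Z unlift_none.
  have ZS : (fun i => Z (lift ord0 i)) = X.
    by apply/funext => i; rewrite /Z liftK.
  have := @der_wedge_prodS p Z; rewrite wedge_prodS /= Z0 ZS; apply.
  by move=> i; rewrite /Z; case: unlift.
Qed.

Lemma der_wedge p q P S : multisec_deg p P -> multisec_deg q S ->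
  D (wedge P S) = wedge (D P) S + wedge P (D S).
Proof.
move=> + dS; have sS := deg_smooth dS.
apply: (@fun_linear_eq _ _ _ _ _ (fun P => D (wedge P S))
  (fun P => wedge (D P) S + wedge P (D S))).
- move=> f {}P Q sf /deg_smooth sP /deg_smooth sQ.
  by rewrite wedge_linl der_lin //; exact: smooth_wedge.
- move=> f {}P Q sf /deg_smooth sP /deg_smooth sQ.
  rewrite der_lin // !wedge_linl; apply: multisec_ext => x.
  by rewrite [LHS]addrACA /fscale -scalerDr.
elim: p => [|p IH] X sX.
  rewrite wedge_prod0 !wedge_fun !fscale1 der_of_fun; last exact: smooth_cst.
  by apply: multisec_ext => x; rewrite -[RHS]/(0 * S x + D S x) mul0r add0r.
rewrite wedge_prodS -wedgeA (@der_wedge_sec (p + q)) //; last first.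
  by apply: deg_wedge => //; exact: deg_wedge_prod.
rewrite IH // (@der_wedge_sec p) //; last exact: deg_wedge_prod.
by rewrite wedgeDl wedgeDr !wedgeA addrA.
Qed.

Lemma der_deg p P : multisec_deg p P -> multisec_deg p (D P).
Proof.
move=> dP; split; first exact/der_smooth/deg_smooth/dP.
move=> x; apply: (local_ind (T := fun x u => ext_pow p u)) dP.
- by move=> y; exact: ext_pow0.
- by move=> y k u v; exact: ext_pow_lin.
- move=> f Q S y sf dQ dS; rewrite (@der_fun_linear p) //.
  rewrite -[X in ext_pow _ (X - _)]/(f y *: D Q y + D S y) subrr.
  exact: ext_pow0.
move=> X y sX; suff [] : multisec_deg p (D (wedge_prod X)) by [].
elim: p X sX => [|p IH] X sX.
  by rewrite wedge_prod0 der_of_fun; [exact: deg0|exact: smooth_cst].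
rewrite der_wedge_prodS //; apply: degD; apply: (@deg_wedge _ _ _ _ 1 p).
- exact/deg_of_sec/N_smooth.
- exact: deg_wedge_prod.
- exact: deg_of_sec.
- exact: IH.
Qed.

End Derivations.

(** Both composites are obtained from products by applying [N] and [K] to one
    or two factors in all possible ways. *)
Lemma derivations_commute (R : realType) (n : nat) (M : manifold R n)
    (A : lie_algebroid M) (N K : sec (fiber A) -> sec (fiber A))
    (D E : multisec A -> multisec A) p P :
  (forall X, smooth_sec X -> smooth_sec (N X)) ->
  (forall X, smooth_sec X -> smooth_sec (K X)) ->
  (forall X, smooth_sec X -> N (K X) = K (N X)) ->
  derivation_extension N D -> derivation_extension K E ->
  multisec_deg p P -> D (E P) = E (D P).
Proof.
move=> sN sK NK extD extE.
apply: (@fun_linear_eq _ _ _ _ p (D \o E) (E \o D)) => /=.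
- move=> f Q S sf /deg_smooth sQ /deg_smooth sS /=.
  by rewrite (der_lin extE) // (der_lin extD) //; apply: (der_smooth extE).
- move=> f Q S sf /deg_smooth sQ /deg_smooth sS /=.
  by rewrite (der_lin extD) // (der_lin extE) //; apply: (der_smooth extD).
elim: p {P} => [|p IH] X sX.
  rewrite wedge_prod0 (der_of_fun extE) ?(der_of_fun extD) //; try exact: smooth_cst.
  have E0 : of_fun A (fun=> 0) = 0.
    by apply: multisec_ext => x; rewrite /of_fun scale0r.
  by rewrite -E0 (der_of_fun extE) ?(der_of_fun extD) //; exact: smooth_cst.
pose X' (i : 'I_p) := X (lift ord0 i).
have dX' : multisec_deg p (wedge_prod X') by by apply: deg_wedge_prod => i; exact: sX.
rewrite (der_wedge_prodS extE) // (der_wedge_prodS extD) //.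
have dE := der_deg sK extE dX'; have dD := der_deg sN extD dX'.
have step (D' : multisec A -> multisec A) N' Y Z Q Q' :
    (forall X, smooth_sec X -> smooth_sec (N' X)) -> derivation_extension N' D' ->
    smooth_sec Y -> smooth_sec Z -> multisec_deg p Q -> multisec_deg p Q' ->
    D' (wedge (of_sec Y) Q + wedge (of_sec Z) Q') =
    wedge (of_sec (N' Y)) Q + wedge (of_sec Y) (D' Q) +
    (wedge (of_sec (N' Z)) Q' + wedge (of_sec Z) (D' Q')).
  move=> sN' ext' sY sZ dQ dQ'.
  rewrite -[wedge (of_sec Y) Q]fscale1 (der_lin ext') ?fscale1; first last.
  - by apply: smooth_wedge; [exact: smooth_of_sec|exact: deg_smooth dQ'].
  - by apply: smooth_wedge; [exact: smooth_of_sec|exact: deg_smooth dQ].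
  - exact: smooth_cst.
  by rewrite !(der_wedge_sec sN' ext' (p := p)).
rewrite (step D N) //; last by apply: sK.
rewrite (step E K) //; last by apply: sN.
by rewrite -(IH X') ?NK // => [|i]; [exact: addrACA|exact: sX].
Qed.

(** * Biderivations of the exterior algebra of sections *)

Section Signs.
Variable R : realType.

Lemma ksignE (z : int) : ksign R z = (-1) ^ z.
Proof.
rewrite /ksign; case: z => k //; rewrite NegzE abszN /= -exprnN.
by rewrite -exprVn invrN1.
Qed.

Lemma ksignD (a b : int) : ksign R (a + b) = ksign R a * ksign R b.
Proof. by rewrite !ksignE expfzDr // oppr_eq0 oner_eq0. Qed.

Lemma ksignS (a b c : int) : a = b + c + c -> ksign R a = ksign R b.
Proof.
move=> ->; rewrite !ksignD -mulrA [X in _ * X](_ : _ = 1) ?mulr1 //.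
by rewrite /ksign -expr2 sqrr_sign.
Qed.

End Signs.

Section Biderivations.
Variables (R : realType) (n : nat) (M : manifold R n) (A : lie_algebroid M).
Implicit Types (P Q S : multisec A) (X Y : sec (fiber A)) (f g : M -> R).
Implicit Types (F G : multisec A -> multisec A -> multisec A).

(** Graded antisymmetry and the Leibniz rule are required on homogeneous
    arguments only: this is what deforming by a derivation preserves, the rule
    [der_wedge] being available for these. *)
Definition biderivation F :=
  [/\ forall P Q, smooth_multisec P -> smooth_multisec Q ->
        smooth_multisec (F P Q),
      forall (k : R) P Q S,
        smooth_multisec P -> smooth_multisec Q -> smooth_multisec S ->
        F (k *: P + Q) S = k *: F P S + F Q S /\
        F S (k *: P + Q) = k *: F S P + F S Q,
      forall (p q : nat) P Q, multisec_deg p P -> multisec_deg q Q ->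
        F P Q = - (ksign R ((p%:Z - 1) * (q%:Z - 1)) *: F Q P)
    & forall (p q s : nat) P Q S,
        multisec_deg p P -> multisec_deg q Q -> multisec_deg s S ->
        F P (wedge Q S) =
        wedge (F P Q) S + ksign R ((p%:Z - 1) * q%:Z) *: wedge Q (F P S)].

Lemma schouten_biderivation F : schouten_bracket F -> biderivation F.
Proof.
case=> sF [lF [_ [_ [_ [aF LF]]]]]; split=> // p q s P Q S dP dQ /deg_smooth.
exact: LF.
Qed.

Lemma biderivation0 F Q : biderivation F -> smooth_multisec Q ->
  F 0 Q = 0 /\ F Q 0 = 0.
Proof.
move=> [_ lF _ _] sQ; have s0 := smooth_multisec0 A.
have := lF 1 0 0 _ s0 s0 sQ; rewrite !scale1r addr0 => -[l r].
have z (u : multisec A) : u = u + u -> u = 0.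
  by move/eqP; rewrite -subr_eq0 opprD addNKr oppr_eq0 => /eqP.
by split; apply: z.
Qed.

(** Families of subspaces stable under multiplication, with degrees. The zero
    family serves to compare biderivations, the grading to show that they lower
    the total degree by one. *)
Definition graded_ideal (T : int -> forall x, ext (fiber A x) -> Prop) :=
  [/\ forall d x, T d x 0,
      forall d x (k : R) u v, T d x u -> T d x v -> T d x (k *: u + v)
    & forall d (q : nat) x u w, T d x u -> ext_pow q w ->
        T (d + q%:Z) x (u * w) /\ T (d + q%:Z) x (w * u)].

(** [F P] is linear over functions modulo [F P f * Q], which lies in the ideal. *)
Lemma biderivation_right F T p P : biderivation F -> graded_ideal T ->
  multisec_deg p P ->
  (forall f x, smooth f -> T (p%:Z - 1) x (F P (of_fun A f) x)) ->
  (forall Y x, smooth_sec Y -> T p%:Z x (F P (of_sec Y) x)) ->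
  forall q Q x, multisec_deg q Q -> T (p%:Z + q%:Z - 1) x (F P Q x).
Proof.
move=> [sF lF aF LF] [T0 Tlin TM] dP Ff FX q; have sP := deg_smooth dP.
have TZ d x (k : R) (u : ext (fiber A x)) : T d x u -> T d x (k *: u).
  by move=> Tu; rewrite -[_ *: _]addr0; apply: Tlin.
have TD d x (u v : ext (fiber A x)) : T d x u -> T d x v -> T d x (u + v).
  by move=> Tu Tv; rewrite -[u]scale1r; apply: Tlin.
apply: local_ind => [x|x k u v|f Q S x sf dQ dS|X x sX].
- exact: T0.
- exact: Tlin.
- have sQ := deg_smooth dQ; have sS := deg_smooth dS.
  have sf' := deg_of_fun A sf; have sfQ := deg_smooth (degZl sf dQ).
  rewrite -[fscale f Q]scale1r (proj2 (lF _ _ _ _ sfQ sS sP)) scale1r.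
  rewrite -wedge_fun (LF p 0%N q) // mulr0 /ksign expr0 scale1r wedge_fun.
  rewrite -[X in T _ _ (X - _)]/(F P (of_fun A f) x * Q x + f x *: F P Q x + F P S x).
  rewrite -(addrA (F P (of_fun A f) x * Q x)) addrK.
  have -> : p%:Z + q%:Z - 1 = p%:Z - 1 + q%:Z by lia.
  by have [] := TM _ q _ _ (Q x) (Ff f x sf) (proj2 dQ x).
elim: q X sX => [|q IH] X sX.
  by rewrite wedge_prod0 addr0; apply: Ff; exact: smooth_cst.
rewrite wedge_prodS.
have sX' i : smooth_sec (X (lift ord0 i)) by exact: sX.
have dX' := deg_wedge_prod sX'; have dX0 := deg_of_sec (sX ord0).
rewrite (LF p 1%N q) //; apply: TD.
  have -> : p%:Z + q.+1%:Z - 1 = p%:Z + q%:Z by lia.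
  by have [] := TM _ q _ _ _ (FX _ x (sX ord0)) (proj2 dX' x).
apply: TZ.
have -> : p%:Z + q.+1%:Z - 1 = p%:Z + q%:Z - 1 + 1%N%:Z by lia.
by have [] := TM _ 1%N _ _ _ (IH _ sX') (proj2 dX0 x).
Qed.

(** By antisymmetry the second argument can be reduced to generators first for
    [P] a function or a section, and then for any [P]. *)
Lemma biderivation_generators F T : biderivation F -> graded_ideal T ->
  (forall f g x, smooth f -> smooth g ->
     T (-1) x (F (of_fun A f) (of_fun A g) x)) ->
  (forall X f x, smooth_sec X -> smooth f -> T 0 x (F (of_sec X) (of_fun A f) x)) ->
  (forall X Y x, smooth_sec X -> smooth_sec Y -> T 1 x (F (of_sec X) (of_sec Y) x)) ->
  forall p q P Q x, multisec_deg p P -> multisec_deg q Q ->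
    T (p%:Z + q%:Z - 1) x (F P Q x).
Proof.
move=> bF iT Fff FXf FXX.
have swap p q P Q d x : multisec_deg p P -> multisec_deg q Q ->
    T d x (F Q P x) -> T d x (F P Q x).
  move=> dP dQ TQP; have [_ _ aF _] := bF; have [T0 Tlin _] := iT.
  rewrite (aF p q) // -scaleNr.
  by have := Tlin d x (- ksign R ((p%:Z - 1) * (q%:Z - 1))) _ 0 TQP (T0 _ _); rewrite addr0.
have Ff f q Q x : smooth f -> multisec_deg q Q ->
    T (q%:Z - 1) x (F (of_fun A f) Q x).
  move=> sf; have df := deg_of_fun A sf.
  have -> : q%:Z - 1 = 0%N%:Z + q%:Z - 1 by lia.
  apply: (biderivation_right bF iT df); first by move=> g y; exact: Fff.
  move=> Y y sY; apply: (swap 0%N 1%N) => //; last exact: FXf.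
  exact: deg_of_sec.
have FX X q Q x : smooth_sec X -> multisec_deg q Q ->
    T q%:Z x (F (of_sec X) Q x).
  move=> sX; have dX := deg_of_sec sX.
  have -> : q%:Z = 1%N%:Z + q%:Z - 1 by lia.
  by apply: (biderivation_right bF iT dX) => [f|Y] y; [exact: FXf|exact: FXX].
move=> p q P Q x dP; apply: (biderivation_right bF iT dP) => [f|Y] {}x sf.
- apply: (swap p 0%N) => //; [exact: deg_of_fun|exact: Ff].
- apply: (swap p 1%N) => //; [exact: deg_of_sec|exact: FX].
Qed.

Definition deg_int (d : int) (x : M) (u : ext (fiber A x)) : Prop :=
  match d with Posz p => ext_pow p u | Negz _ => u = 0 end.

Lemma graded_ideal_deg : graded_ideal deg_int.
Proof.
split=> [[d|d] x|[d|d] x k u v|[d|d] q x u w] //=.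
- exact: ext_pow0.
- exact: ext_pow_lin.
- by move=> -> ->; rewrite scaler0 addr0.
- by move=> du qw; split; [|rewrite addnC]; exact: ext_powM.
- move=> -> _; rewrite mul0r mulr0; case: (_ + _) => e /=; split=> //; exact: ext_pow0.
Qed.

Lemma graded_ideal0 : graded_ideal (fun _ _ u => u = 0).
Proof.
split=> // [d x k u v -> ->|d q x u w -> _]; first by rewrite scaler0 addr0.
by rewrite mul0r mulr0.
Qed.

Lemma biderivation_eq F G : biderivation F -> biderivation G ->
  (forall f g, smooth f -> smooth g ->
     F (of_fun A f) (of_fun A g) = G (of_fun A f) (of_fun A g)) ->
  (forall X f, smooth_sec X -> smooth f ->
     F (of_sec X) (of_fun A f) = G (of_sec X) (of_fun A f)) ->
  (forall X Y, smooth_sec X -> smooth_sec Y ->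
     F (of_sec X) (of_sec Y) = G (of_sec X) (of_sec Y)) ->
  forall p q P Q, multisec_deg p P -> multisec_deg q Q -> F P Q = G P Q.
Proof.
move=> [sF lF aF LF] [sG lG aG LG] Hff HXf HXX p q P Q dP dQ.
have bH : biderivation (fun P Q => F P Q - G P Q).
  split.
  - by move=> P' Q' sP' sQ'; apply: smooth_multisecB; [exact: sF|exact: sG].
  - move=> k P' Q' S sP' sQ' sS.
    have [-> ->] := lF k _ _ _ sP' sQ' sS; have [-> ->] := lG k _ _ _ sP' sQ' sS.
    by rewrite !scalerBr !opprD; split; exact: addrACA.
  - move=> p' q' P' Q' dP' dQ'; rewrite (aF p' q') // (aG p' q') //.
    by rewrite scalerBr opprB opprK addrC.
  - move=> p' q' s' P' Q' S dP' dQ' dS.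
    rewrite (LF p' q' s') // (LG p' q' s') // wedgeBl wedgeBr scalerBr opprD.
    exact: addrACA.
apply: multisec_ext => x; apply/eqP; rewrite -subr_eq0; apply/eqP.
have H := biderivation_generators bH graded_ideal0.
apply: (H _ _ _ p q P Q x) => //.
- by move=> f g y sf sg; rewrite Hff // subrr.
- by move=> X f y sX sf; rewrite HXf // subrr.
- by move=> X Y y sX sY; rewrite HXX // subrr.
Qed.

(** When [D] extends [N], this extends the bracket [deformed_bracket N] of
    sections. *)
Definition deformed D F P Q := F (D P) Q + F P (D Q) - D (F P Q).

Definition lowers_degree F := forall p q P Q x,
  multisec_deg p P -> multisec_deg q Q ->
  deg_int (p%:Z + q%:Z - 1) (F P Q x).

Lemma lowers_degree_deg F p q P Q : biderivation F -> lowers_degree F ->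
  multisec_deg p P -> multisec_deg q Q -> exists r, multisec_deg r (F P Q).
Proof.
move=> [sF _ _ _] dF dP dQ; have sFPQ := sF _ _ (deg_smooth dP) (deg_smooth dQ).
have := fun x => dF p q P Q x dP dQ; case: (_ - 1) => [r|r] /= H.
  by exists r.
by exists 0%N; split=> // x; rewrite H; exact: ext_pow0.
Qed.

Lemma schouten_lowers_degree F : schouten_bracket F -> lowers_degree F.
Proof.
move=> sch p q P Q x; have bF := schouten_biderivation sch.
have [_ [_ [FXf [FXX [Fff _]]]]] := sch.
apply: (biderivation_generators bF graded_ideal_deg) => {p q P Q x}.
- by move=> f g x sf sg; rewrite Fff.
- move=> X f x sX sf; rewrite FXf //.
  by have [_] := deg_of_fun A (anchor_smooth sX sf); apply.
- move=> X Y x sX sY; rewrite FXX //.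
  by have [_] := deg_of_sec (lbracket_smooth sX sY); apply.
Qed.

Section Deformation.
Variables (N : sec (fiber A) -> sec (fiber A)) (D : multisec A -> multisec A).
Hypothesis N_smooth : forall X, smooth_sec X -> smooth_sec (N X).
Hypothesis D_ext : derivation_extension N D.

Lemma der_linZ (k : R) P Q : smooth_multisec P -> smooth_multisec Q ->
  D (k *: P + Q) = k *: D P + D Q.
Proof. by move=> sP sQ; rewrite -fscale_cst (der_lin D_ext) //; exact: smooth_cst. Qed.

Lemma der0 : D 0 = 0.
Proof.
have := der_linZ 1 (smooth_multisec0 A) (smooth_multisec0 A).
by rewrite !scale1r addr0 => /eqP; rewrite -subr_eq0 opprD addNKr oppr_eq0 => /eqP.
Qed.

Lemma derZ k P : smooth_multisec P -> D (k *: P) = k *: D P.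
Proof.
move=> sP; rewrite -[k *: P]addr0 der_linZ //; last exact: smooth_multisec0.
by rewrite der0 addr0.
Qed.

Lemma deformed_biderivation F : biderivation F -> lowers_degree F ->
  biderivation (deformed D F).
Proof.
move=> bF degF; have [sF lF aF LF] := bF.
have sD P : smooth_multisec P -> smooth_multisec (D P) by exact: (der_smooth D_ext).
have dD p P : multisec_deg p P -> multisec_deg p (D P) by exact: (der_deg N_smooth D_ext).
split.
- move=> P Q sP sQ; apply: smooth_multisecB; last exact/sD/sF.
  by apply: smooth_multisecD; apply: sF => //; exact: sD.
- move=> k P Q S sP sQ sS; have [sDP sDQ sDS] := And3 (sD _ sP) (sD _ sQ) (sD _ sS).
  rewrite /deformed der_linZ //.
  have [-> ->] := lF k _ _ _ sP sQ sS.
  have [-> ->] := lF k _ _ _ sDP sDQ sS.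
  have [-> ->] := lF k _ _ _ sP sQ sDS.
  rewrite !der_linZ; try exact: sF.
  by rewrite !scalerBr !scalerDr !opprD; split;
    exact: (AC ((2*2)*2) ((1*3*5)*(2*4*6))).
- move=> p q P Q dP dQ; rewrite /deformed.
  rewrite (aF p q _ _ (dD _ _ dP) dQ) (aF p q _ _ dP (dD _ _ dQ)) (aF p q _ _ dP dQ).
  rewrite -!scaleNr derZ; last exact: (sF _ _ (deg_smooth dQ) (deg_smooth dP)).
  by rewrite -scalerDr -scalerBr [F Q _ + _]addrC.
- move=> p q s P Q S dP dQ dS.
  have [dDP dDQ dDS] := And3 (dD _ _ dP) (dD _ _ dQ) (dD _ _ dS).
  have [r dFPQ] := lowers_degree_deg bF degF dP dQ.
  have [r' dFPS] := lowers_degree_deg bF degF dP dS.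
  rewrite /deformed (LF p q s (D P)) // (der_wedge N_smooth D_ext dQ dS).
  rewrite -[wedge (D Q) S]scale1r (proj2 (lF _ _ _ _ _ _ _)) ?scale1r; first last.
  - exact: deg_smooth dP.
  - exact: smooth_wedge (deg_smooth dQ) (deg_smooth dDS).
  - exact: smooth_wedge (deg_smooth dDQ) (deg_smooth dS).
  rewrite (LF p q s P (D Q)) // (LF p q s P Q (D S)) // (LF p q s P Q S) //.
  set c := ksign _ _.
  rewrite [wedge (F P Q) S + _]addrC der_linZ; first last.
  - exact: smooth_wedge (deg_smooth dFPQ) (deg_smooth dS).
  - exact: smooth_wedge (deg_smooth dQ) (deg_smooth dFPS).
  rewrite (der_wedge N_smooth D_ext dFPQ dS) (der_wedge N_smooth D_ext dQ dFPS).
  rewrite wedgeBl wedgeDl wedgeBr wedgeDr !scalerBr !scalerDr !opprD.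
  (* The terms [D Q /\ F P S] and [F P Q /\ D S] cancel. *)
  rewrite [LHS](AC ((2*(2*2))*(2*2)) (((1*3*9)*(2*6*8))*((4*7)*(5*10)))).
  by rewrite /= !subrr !addr0.
Qed.

Lemma deformed_lowers_degree F : biderivation F -> lowers_degree F ->
  lowers_degree (deformed D F).
Proof.
move=> bF degF p q P Q x dP dQ; have [sF _ _ _] := bF.
have [T0 Tlin _] := graded_ideal_deg.
have dDP := der_deg N_smooth D_ext dP; have dDQ := der_deg N_smooth D_ext dQ.
rewrite -[X in deg_int _ X]/(F (D P) Q x + F P (D Q) x - D (F P Q) x).
set d := _ - 1; have TD u v : deg_int (x := x) d u -> deg_int d v -> deg_int d (u + v).
  by move=> du dv; rewrite -[u]scale1r; apply: Tlin.
apply: (TD); first by apply: TD; exact: degF.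
rewrite -scaleN1r -[_ *: _]addr0; apply: Tlin => //.
have sFPQ := sF _ _ (deg_smooth dP) (deg_smooth dQ).
have := fun y => degF p q P Q y dP dQ; rewrite -/d.
case: d {TD} => r /= H.
  by have [_] := der_deg N_smooth D_ext (conj sFPQ H); apply.
by rewrite (multisec_ext (Q := 0) H) der0.
Qed.

Lemma deformed_fun_fun F f g : biderivation F -> smooth f -> smooth g ->
  F (of_fun A f) (of_fun A g) = 0 ->
  deformed D F (of_fun A f) (of_fun A g) = 0.
Proof.
move=> bF sf sg Ffg; rewrite /deformed !(der_of_fun D_ext) // Ffg der0.
have [-> _] := biderivation0 bF (smooth_of_fun sg).
have [_ ->] := biderivation0 bF (smooth_of_fun sf).
by rewrite subr0 addr0.
Qed.

Lemma deformed_sec_fun F (a : sec (fiber A) -> (M -> R) -> M -> R) X f :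
  biderivation F -> smooth_sec X -> smooth f ->
  (forall Y, smooth_sec Y -> smooth (a Y f)) ->
  (forall Y, smooth_sec Y -> F (of_sec Y) (of_fun A f) = of_fun A (a Y f)) ->
  deformed D F (of_sec X) (of_fun A f) = of_fun A (a (N X) f).
Proof.
move=> bF sX sf sa Fa; have [_ F0] := biderivation0 bF (smooth_of_sec sX).
have sNX := N_smooth sX; have saX := sa _ sX.
rewrite /deformed (der_of_sec D_ext) // Fa // (der_of_fun D_ext) // F0.
by rewrite Fa // (der_of_fun D_ext) // addr0 subr0.
Qed.

Lemma of_secD X Y : of_sec (X + Y) = of_sec X + of_sec Y.
Proof. by apply: multisec_ext => x; exact: (raddfD (@ext_inj R (fiber A x))). Qed.

Lemma of_secB X Y : of_sec (X - Y) = of_sec X - of_sec Y.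
Proof. by apply: multisec_ext => x; exact: (raddfB (@ext_inj R (fiber A x))). Qed.

Lemma deformed_sec_sec F (b : sec (fiber A) -> sec (fiber A) -> sec (fiber A)) X Y :
  smooth_sec X -> smooth_sec Y ->
  (forall X Y, smooth_sec X -> smooth_sec Y -> smooth_sec (b X Y)) ->
  (forall X Y, smooth_sec X -> smooth_sec Y ->
     F (of_sec X) (of_sec Y) = of_sec (b X Y)) ->
  deformed D F (of_sec X) (of_sec Y) =
  of_sec (b (N X) Y + b X (N Y) - N (b X Y)).
Proof.
move=> sX sY sb Fb; have sNX := N_smooth sX; have sNY := N_smooth sY.
have sbXY := sb _ _ sX sY; rewrite /deformed !(der_of_sec D_ext) // !Fb //.
by rewrite (der_of_sec D_ext) // -of_secD -of_secB.
Qed.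

End Deformation.

(** Both sides are biderivations, so they are compared on generators; for two
    sections the comparison is twice the Nijenhuis identity, the first use
    cancelling one bracket [N X, N Y] and the second expanding the other. *)
Lemma deformed_square (N : sec (fiber A) -> sec (fiber A)) D E F :
  nijenhuis_tensor N -> derivation_extension N D ->
  derivation_extension (fun X => N (N X)) E -> schouten_bracket F ->
  forall p q P Q, multisec_deg p P -> multisec_deg q Q ->
    deformed D (deformed D F) P Q = deformed E F P Q.
Proof.
move=> [[sN lN] nij] extD extE sch.
have sNN X : smooth_sec X -> smooth_sec (N (N X)) by move=> /sN/sN.
have bF := schouten_biderivation sch; have degF := schouten_lowers_degree sch.
have bDF := deformed_biderivation sN extD bF degF.
have degDF := deformed_lowers_degree sN extD bF degF.
have [_ [_ [FXf [FXX [Fff _]]]]] := sch.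
apply: (biderivation_eq (deformed_biderivation sN extD bDF degDF)
  (deformed_biderivation sNN extE bF degF)).
- move=> f g sf sg; rewrite (deformed_fun_fun extE) ?Fff //.
  by rewrite (deformed_fun_fun extD) // (deformed_fun_fun extD) // Fff.
- move=> X f sX sf.
  pose a (Y : sec (fiber A)) (h : M -> R) : M -> R := fun x => anchor (Y x) h.
  have sa Y : smooth_sec Y -> smooth (a Y f) by move=> sY; exact: anchor_smooth.
  have Fa Y : smooth_sec Y -> F (of_sec Y) (of_fun A f) = of_fun A (a Y f).
    by move=> sY; exact: FXf.
  rewrite (deformed_sec_fun (a := a) sNN extE) //.
  rewrite (deformed_sec_fun (a := fun Y => a (N Y)) sN extD) //.
    by move=> Y sY; apply/sa/sN.
  by move=> Y sY; rewrite (deformed_sec_fun (a := a) sN extD).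
move=> X Y sX sY; have sb := fun X Y => @lbracket_smooth _ _ _ A X Y.
rewrite (deformed_sec_sec sNN extE sX sY sb FXX).
have sdef X' Y' : smooth_sec X' -> smooth_sec Y' ->
    smooth_sec (deformed_bracket N X' Y').
  move=> sX' sY'; apply: smooth_secD; last exact/smooth_secN/sN/sb.
  by apply: smooth_secD; apply: sb => //; exact: sN.
rewrite (deformed_sec_sec (b := deformed_bracket N) sN extD sX sY sdef); last first.
  by move=> X' Y' sX' sY'; rewrite (deformed_sec_sec sN extD sX' sY' sb FXX).
congr of_sec; rewrite {1 2}/deformed_bracket.
have N1 k X' Y' : smooth_sec X' -> smooth_sec Y' ->
    N (k *: X' + Y') = k *: N X' + N Y'.
  by move=> sX' sY'; exact: (lN _ _ _ (smooth_cst k) sX' sY').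
have ND X' Y' : smooth_sec X' -> smooth_sec Y' -> N (X' + Y') = N X' + N Y'.
  by move=> sX' sY'; rewrite -[X']scale1r N1 // !scale1r.
have NB X' Y' : smooth_sec X' -> smooth_sec Y' -> N (X' - Y') = N X' - N Y'.
  by move=> sX' sY'; rewrite addrC -scaleN1r N1 // scaleN1r addrC.
have /eqP := nij X Y sX sY; rewrite subr_eq0 => /eqP nijE.
have mE : lbracket (N X) (N Y) =
    N (lbracket (N X) Y) + N (lbracket X (N Y)) - N (N (lbracket X Y)).
  have sNX := sN _ sX; have sNY := sN _ sY.
  rewrite nijE /deformed_bracket NB; last exact/sN/sb.
    by rewrite ND //; exact: sb.
  by apply: smooth_secD; exact: sb.
rewrite -nijE [LHS](AC (3*3*1) (((1*5)*(2*3*6))*(4*7))) /= subrr addr0.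
congr (_ + _); rewrite mE [LHS](ACl (3*((1*4)*(2*5)))) /=.
by rewrite !subrr !addr0.
Qed.

End Biderivations.

(** * Brackets of low arity *)

Section LowArity.
Variables (R : fieldType) (V : lmodType R).
Implicit Types (K L : vform V) (x y : int * V).

Lemma ord2_cases (i : 'I_2) : i = ord0 \/ i = ord_max.
Proof. by case: i => [[|[|//]]] ?; [left|right]; apply: val_inj. Qed.

Lemma perm2_cases (s : 'S_2) : s = 1%g \/ s = tperm ord0 ord_max.
Proof.
have ord2 := ord2_cases.
have ne : s ord0 != s ord_max by rewrite (inj_eq perm_inj).
case: (ord2 (s ord0)) (ord2 (s ord_max)) ne => h0 [] h1; rewrite h0 h1 ?eqxx // => _.
  by left; apply/permP => i; rewrite perm1; case: (ord2 i) => ->.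
by right; apply/permP => i; case: (ord2 i) => ->; rewrite ?tpermL ?tpermR.
Qed.

Lemma sum_perm2 (F : 'S_2 -> V) :
  \sum_(s : 'S_2) F s = F 1%g + F (tperm ord0 ord_max).
Proof.
have ne : tperm ord0 ord_max != 1%g :> 'S_2.
  apply/eqP => /permP /(_ ord0); rewrite tpermL perm1 => /(congr1 val).
  by [].
rewrite (bigD1 (1%g : 'S_2)) //= (bigD1 (tperm ord0 ord_max)) //= big1 ?addr0 // => s.
by case/andP; case: (perm2_cases s) => ->; rewrite eqxx.
Qed.

Lemma unshuffle2 (s : 'S_2) : unshuffle 1 s.
Proof.
apply/forallP => i; apply/forallP => j; apply/implyP.
by case: i j => [[|[|//]] ?] [[|[|//]] ?].
Qed.

Lemma unshuffle_full n (s : 'S_n) : unshuffle n s = (s == 1%g).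
Proof.
apply/idP/eqP => [/forallP us|->]; last first.
  by apply/forallP => i; apply/forallP => j; rewrite !perm1; apply/implyP => /andP[].
have sorted_enum : sorted (relpre val ltn) (enum 'I_n).
  by rewrite -sorted_map val_enum_ord iota_ltn_sorted.
have eq_enum : [seq val (s i) | i <- enum 'I_n] = [seq val i | i <- enum 'I_n].
  apply: (irr_sorted_eq ltn_trans ltnn).
  - apply: (homo_sorted (e := relpre val ltn)) sorted_enum => i j /= ij.
    by have /forallP/(_ j)/implyP := us i; apply; rewrite ij ltn_ord.
  - by rewrite sorted_map.
  - move=> k; apply/mapP/mapP => [] [i _ ->].
      by exists (s i); rewrite ?mem_enum.
    by exists (s^-1%g i); rewrite ?mem_enum ?permKV.
apply/permP => i; rewrite perm1; apply: val_inj.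
by have /eq_in_map := eq_enum; apply; rewrite mem_enum.
Qed.

Lemma permuted1 (X : seq (int * V)) : permuted (1%g : 'S_(size X)) = X.
Proof.
rewrite /permuted; under eq_map do rewrite perm1.
by rewrite (map_comp (nth (0, 0) X) val) val_enum_ord -/(mkseq _ _) mkseq_nth.
Qed.

Lemma koszul_sign1 (X : seq (int * V)) : koszul_sign (1%g : 'S_(size X)) = 1.
Proof.
rewrite /koszul_sign big1 // => i _; rewrite big1 // => j.
by rewrite !perm1 => /andP[/ltnW]; rewrite leqNgt => /negbTE ->.
Qed.

Lemma permuted_swap x y :
  permuted (tperm ord0 ord_max : 'S_(size [:: x; y])) = [:: y; x].
Proof.
rewrite /permuted /= enum_ordSl enum_ordSl /= tpermL.
have -> : lift ord0 ord0 = ord_max :> 'I_2 by apply: val_inj.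
have -> : enum 'I_0 = [::] by apply: size0nil; rewrite -cardE card_ord.
by rewrite tpermR.
Qed.

Lemma koszul_sign_swap x y :
  koszul_sign (tperm ord0 ord_max : 'S_(size [:: x; y])) = ksign R (x.1 * y.1).
Proof.
rewrite /koszul_sign /= big_ord_recl big_ord1 /=.
have -> : lift ord0 ord0 = ord_max :> 'I_2 by apply: val_inj.
rewrite [X in _ * X]big_pred0 => [|j]; last first.
  by rewrite ltnNge -ltnS ltn_ord.
rewrite mulr1 (big_pred1 ord_max) => [|j]; first by rewrite tpermL tpermR /= mulrC.
by case: (ord2_cases j) => ->; rewrite ?tpermL ?tpermR.
Qed.

Lemma insertion12 K L x y : arity K = 1%N ->
  insertion K L [:: x; y] =
    L [:: (x.1 + vdegree K, K [:: x]); y] +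
    ksign R (x.1 * y.1) *: L [:: (y.1 + vdegree K, K [:: y]); x].
Proof.
move=> K1; rewrite /insertion K1 (eq_bigl xpredT); last exact: unshuffle2.
rewrite sum_perm2 permuted1 koszul_sign1 permuted_swap koszul_sign_swap scale1r.
by rewrite /total_degree /= !big_seq1.
Qed.

Lemma insertion_full K L X : arity K = size X ->
  insertion K L X = L [:: (total_degree X + vdegree K, K X)].
Proof.
move=> KX; rewrite /insertion KX (big_pred1 (1%g : 'S_(size X))).
  by rewrite permuted1 koszul_sign1 scale1r take_size drop_size.
by move=> s; exact: unshuffle_full.
Qed.

End LowArity.

(** * Nijenhuis forms on multisections *)

Section GradedForms.
Variables (R : realType) (n : nat) (M : manifold R n) (A : lie_algebroid M).
Implicit Types (P Q S : multisec A) (F : multisec A -> multisec A -> multisec A).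

Lemma shifted_deg_cases d P : @shifted_deg R n M A d P ->
  (exists2 p : nat, d = p%:Z - 2 & multisec_deg p P) \/ P = 0.
Proof.
rewrite /shifted_deg; case E: (d + 2) => [p|p] H; last by right.
by left; exists p => //; rewrite -E addrK.
Qed.

Lemma shifted_deg0 d : @shifted_deg R n M A d 0.
Proof. by rewrite /shifted_deg; case: (d + 2) => p //; exact: deg0. Qed.

Lemma shifted_deg_smooth d P : @shifted_deg R n M A d P -> smooth_multisec P.
Proof.
case/shifted_deg_cases => [[p _ /deg_smooth //]|->]; exact: smooth_multisec0.
Qed.

Lemma shifted_degZ d k P : @shifted_deg R n M A d P ->
  @shifted_deg R n M A d (k *: P).
Proof.
rewrite /shifted_deg; case: (d + 2) => p /=; first exact: degZ.
by move=> ->; rewrite scaler0.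
Qed.

(** With [d = p - 2], the sign [(-1)^(p-1)] turns the antisymmetry of the bracket
    into graded symmetry for the shifted degrees. *)
Lemma biderivation_swap F d e P Q : biderivation F ->
  @shifted_deg R n M A d P -> @shifted_deg R n M A e Q ->
  ksign R (d + 1) *: F P Q = ksign R (d * e) *: (ksign R (e + 1) *: F Q P).
Proof.
move=> bF HP HQ; have sP := shifted_deg_smooth HP; have sQ := shifted_deg_smooth HQ.
case: (shifted_deg_cases HP) => [[p dE dP]|->]; last first.
  by have [-> ->] := biderivation0 bF sQ; rewrite !scaler0.
case: (shifted_deg_cases HQ) => [[q eE dQ]|->]; last first.
  by have [-> ->] := biderivation0 bF sP; rewrite !scaler0.
have [_ _ aF _] := bF; rewrite (aF p q) // -scaleNr !scalerA; congr (_ *: _).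
rewrite mulrN -mulN1r -[-1](_ : ksign R 1 = _); last by rewrite /ksign expr1.
rewrite -!ksignD; apply: (@ksignS R _ _ (d + 1)).
by rewrite dE eE; ring.
Qed.

Lemma biderivation_shifted_deg F d e P Q : biderivation F -> lowers_degree F ->
  @shifted_deg R n M A d P -> @shifted_deg R n M A e Q ->
  @shifted_deg R n M A (d + e + 1) (F P Q).
Proof.
move=> bF degF HP HQ.
have sP := shifted_deg_smooth HP; have sQ := shifted_deg_smooth HQ.
case: (shifted_deg_cases HP) => [[p dE dP]|->]; last first.
  by have [-> _] := biderivation0 bF sQ; exact: shifted_deg0.
case: (shifted_deg_cases HQ) => [[q eE dQ]|->]; last first.
  by have [_ ->] := biderivation0 bF sP; exact: shifted_deg0.
have [sF _ _ _] := bF; have := fun x => degF p q P Q x dP dQ.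
rewrite /shifted_deg (_ : d + e + 1 + 2 = p%:Z + q%:Z - 1); last first.
  by rewrite dE eE; ring.
case: (_ - 1) => r /= H; first by split=> //; apply: sF.
exact: multisec_ext.
Qed.

Lemma homogeneous2 (x y : int * multisec A) :
  homogeneous (@shifted_deg R n M A) [:: x; y] <->
  shifted_deg x.1 x.2 /\ shifted_deg y.1 y.2.
Proof.
split=> [h|[hx hy]]; first by split; [exact: (h 0%N)|exact: (h 1%N)].
by case=> [|[|//]].
Qed.

Lemma homogeneous1 (x : int * multisec A) :
  homogeneous (@shifted_deg R n M A) [:: x] -> shifted_deg x.1 x.2.
Proof. by move=> h; exact: (h 0%N). Qed.

Lemma symmetric_l2_form F : biderivation F -> lowers_degree F ->
  symmetric_vform (@shifted_deg R n M A) (l2_form F).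
Proof.
move=> bF degF; have [_ lF _ _] := bF; split.
- move=> [|x [|y [|]]] //= _ /homogeneous2[hx hy].
  rewrite /total_degree !big_cons big_nil addr0.
  by apply: shifted_degZ; exact: biderivation_shifted_deg.
- move=> [|x X] [|y Y] d k u v; rewrite /= ?addSn ?addnS //.
    case: Y => // _ /homogeneous2[/= h1 h2] /homogeneous2[/= h3 h4].
    have [-> _] := lF k _ _ _ (shifted_deg_smooth h1) (shifted_deg_smooth h3)
      (shifted_deg_smooth h2).
    by rewrite scalerDr !scalerA mulrC.
  case: X => // _ /homogeneous2[/= h1 h2] /homogeneous2[/= h3 h4].
  have [_ ->] := lF k _ _ _ (shifted_deg_smooth h2) (shifted_deg_smooth h4)
    (shifted_deg_smooth h1).
  by rewrite scalerDr !scalerA mulrC.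
- move=> [|? X] [|? Y] x y; rewrite /= ?addSn ?addnS // => _ /homogeneous2[hx hy].
  exact: biderivation_swap.
Qed.

Section Derivation.
Variables (N : sec (fiber A) -> sec (fiber A)) (D : multisec A -> multisec A).
Hypothesis N_smooth : forall X, smooth_sec X -> smooth_sec (N X).
Hypothesis D_ext : derivation_extension N D.

Lemma der_shifted_deg d P :
  @shifted_deg R n M A d P -> @shifted_deg R n M A d (D P).
Proof.
rewrite /shifted_deg; case: (d + 2) => p /=; first exact: (der_deg N_smooth D_ext).
by move=> ->; rewrite (der0 D_ext).
Qed.

Lemma symmetric_der_form : symmetric_vform (@shifted_deg R n M A) (vform1 0 D).
Proof.
split.
- move=> [|x [|]] //= _ /homogeneous1 hx.
  by rewrite /total_degree big_seq1 addr0; exact: der_shifted_deg.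
- move=> [|x X] [|y Y] //= d k u v _ /homogeneous1 hu /homogeneous1 hv.
  by apply: (der_linZ D_ext); [exact: shifted_deg_smooth hu|exact: shifted_deg_smooth hv].
- by move=> [|x X] Y //= x' y'; rewrite addnS.
Qed.

(** The insertion of [D] in the first slot of [L], composed with the exchange of
    the arguments, is by graded symmetry the insertion in the second slot. *)
Lemma RN_bracket_deformed F (L : vform (multisec A)) :
  biderivation F -> arity L = 2%N ->
  (forall x y, shifted_deg x.1 x.2 -> shifted_deg y.1 y.2 ->
     L [:: x; y] = ksign R (x.1 + 1) *: F x.2 y.2) ->
  forall x y, shifted_deg x.1 x.2 -> shifted_deg y.1 y.2 ->
    RN_bracket (vform1 0 D) L [:: x; y] =
    ksign R (x.1 + 1) *: deformed D F x.2 y.2.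
Proof.
move=> bF L2 LF x y hx hy; have [sF _ _ _] := bF.
have hDx := der_shifted_deg hx; have hDy := der_shifted_deg hy.
rewrite /= insertion12 // insertion_full ?L2 // mul0r scale1r /= !addr0.
rewrite !LF //= -(biderivation_swap bF hx hDy) (derZ D_ext); last first.
  exact: (sF _ _ (shifted_deg_smooth hx) (shifted_deg_smooth hy)).
by rewrite -scalerDr -scalerBr.
Qed.

End Derivation.

End GradedForms.

Theorem proposition2p7p4 (R : realType) (n : nat) (M : manifold R n)
    (A : lie_algebroid M)
    (N : sec (fiber A) -> sec (fiber A))
    (N_nijenhuis : nijenhuis_tensor N)
    (SN : multisec A -> multisec A -> multisec A)
    (SN_schouten : schouten_bracket SN)
    (N_ext : multisec A -> multisec A)
    (N_extP : derivation_extension N N_ext)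
    (N2_ext : multisec A -> multisec A)
    (N2_extP : derivation_extension (fun X => N (N X)) N2_ext) :
  nijenhuis_vform (@shifted_deg R n M A)
    (l2_form SN) (vform1 0%R N_ext) (vform1 0%R N2_ext).
Proof.
have [[sN _] _] := N_nijenhuis.
have sNN X : smooth_sec X -> smooth_sec (N (N X)) by move=> /sN/sN.
have bS := schouten_biderivation SN_schouten.
have dS := schouten_lowers_degree SN_schouten.
have bN := deformed_biderivation sN N_extP bS dS.
have dN := deformed_lowers_degree sN N_extP bS dS.
have bNN := deformed_biderivation sN N_extP bN dN.
have bN2 := deformed_biderivation sNN N2_extP bS dS.
split.
- by split=> //; exact: symmetric_l2_form.
- by split=> //; exact: symmetric_der_form N_extP.
- by split=> //; exact: symmetric_der_form N2_extP.
- split=> // -[|x [|y [|]]] // _ /homogeneous2[hx hy].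
  rewrite (RN_bracket_deformed sNN N2_extP bS) //.
  rewrite (RN_bracket_deformed sN N_extP bN) //; last first.
    by move=> x' y' hx' hy'; rewrite (RN_bracket_deformed sN N_extP bS).
  congr (_ *: _); have sx := shifted_deg_smooth hx; have sy := shifted_deg_smooth hy.
  case: (shifted_deg_cases hx) => [[p _ dx]|->]; last first.
    by have [-> _] := biderivation0 bNN sy; have [-> _] := biderivation0 bN2 sy.
  case: (shifted_deg_cases hy) => [[q _ dy]|->]; last first.
    by have [_ ->] := biderivation0 bNN sx; have [_ ->] := biderivation0 bN2 sx.
  exact: (deformed_square N_nijenhuis N_extP N2_extP SN_schouten dx dy).
move=> [|x [|]] // _ /homogeneous1 hx.
rewrite /= !insertion_full //= mul0r scale1r.
case: (shifted_deg_cases hx) => [[p _ dx]|->]; last first.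
  by rewrite (der0 N_extP) (der0 N2_extP) (der0 N_extP) subrr.
by rewrite (derivations_commute sN sNN _ N_extP N2_extP dx) ?subrr.
Qed.
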